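(* Let $K$ be a global function field over a finite field $k$ of characteristic $p>0$, let $\Sigma_K$ be its set of places, let $\Sigma\subset\Sigma_K$ be a cofinite subset and put $S=\Sigma_K\setminus\Sigma$. Let $\Gamma\subset K^*$ be a subgroup with $\Gamma\subset O_{S_0}^*$ for some finite $S_0\subset\Sigma_K$. Suppose that $\Gamma\cap O_S^*$ has rank at most one. Then for every natural number $M$ and every closed $K$-variety $W$ in the affine space $\mathbb{A}^M$, we have $W(\overline{\Gamma})=\overline{W(\Gamma)}$.
   Context: For a place $v$, $K_v$ is the completion of $K$ at $v$, with valuation ring $O_v$ and maximal ideal $\mathfrak m_v$. For a finite set $S'\subset\Sigma_K$, $O_{S'}$ is the ring of $S'$-integers of $K$ (elements $x\in K$ with $v(x)\ge 0$ for all $v\notin S'$), and $O_{S'}^*$ its unit group. The rank of a finitely generated abelian group is the rank of its free part. The product $\prod_{v\in\Sigma}K_v^*$ carries the product topology, and $K$ (hence $\Gamma$) is embedded diagonally in $\prod_{v\in\Sigma}K_v$. $\overline{\Gamma}$ denotes the topological closure of the diagonal image of $\Gamma$ in $\prod_{v\in\Sigma}K_v^*$. For a closed $K$-variety $W\subset\mathbb A^M$ and a subset $\Theta$ of a ring containing $K$, $W(\Theta)$ is the set of points of $W$ (i.e. common zeros of defining polynomials of $W$) all of whose coordinates lie in $\Theta$. $\overline{W(\Gamma)}$ denotes the topological closure of the diagonal image of $W(\Gamma)$ in $W(\prod_{v\in\Sigma}K_v^* )\subset(\prod_{v\in\Sigma}K_v^* )^M$. *)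

(* Defs.v *)
From HB Require Import structures.
From mathcomp Require Import all_boot all_order all_algebra all_field.
From mathcomp Require Import fraction.
From Stdlib Require List.
From mathcomp Require Import mpoly.
Set Implicit Arguments. Unset Strict Implicit. Unset Printing Implicit Defensive.
Import Order.TTheory GRing.Theory Num.Theory.
Local Open Scope ring_scope.

(* The rational function field F_p(t). A global function field of
   characteristic p is (up to isomorphism) exactly a finite field extension K
   of F_p(t): its constant field k is the (finite) algebraic closure of F_p in K. *)
Definition ratfun (p : nat) := {fraction {poly 'F_p}}.

Section Defs.
Variable (F : fieldType) (K : fieldExtType F).

(* A place of K, represented by its normalized discrete valuation
   v : K^* ->> Z (with the convention v 0 = 0; "v x >= N" for x = 0 is
   handled by [vge] below, i.e. v(0) = +oo). *)
Definition is_place (v : K -> int) : Prop :=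
  [/\ v 0 = 0,
      (forall x y, x != 0 -> y != 0 -> v (x * y) = v x + v y),
      (forall x y, x != 0 -> y != 0 -> x + y != 0 -> Num.min (v x) (v y) <= v (x + y))
    & (forall n : int, exists x, x != 0 /\ v x = n)].

Definition vge (v : K -> int) (x : K) (N : int) : bool := (x == 0) || (N <= v x).

Definition in_Sigma (S : seq (K -> int)) (v : K -> int) : Prop :=
  is_place v /\ ~ List.In v S.

Definition S_unit (S' : seq (K -> int)) (x : K) : Prop :=
  x != 0 /\ forall v, is_place v -> ~ List.In v S' -> v x = 0.

Definition is_subgroup_units (G : K -> Prop) : Prop :=
  [/\ G 1, (forall x, G x -> x != 0) & (forall x y, G x -> G y -> G (x / y))].

Definition rank_le (G : K -> Prop) (r : nat) : Prop :=
  forall a : 'I_r.+1 -> K, (forall i, G (a i)) ->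
    exists e : 'I_r.+1 -> int, (exists i, e i != 0) /\ \prod_i (a i) ^ (e i) = 1.

(* Completions K_v are modelled by v-Cauchy sequences in K.
   Elements of K_v: v-Cauchy sequences; u represents 0 iff u is v-null. *)
Definition vnull (v : K -> int) (u : nat -> K) : Prop :=
  forall N : int, exists n0, forall n, (n0 <= n)%N -> vge v (u n) N.

Definition vcauchy (v : K -> int) (u : nat -> K) : Prop :=
  forall N : int, exists n0, forall n m, (n0 <= n)%N -> (n0 <= m)%N -> vge v (u n - u m) N.

(* the element a of K (embedded in K_v) lies in the basic neighbourhood
   { y in K_v | v(y - lim u) >= N } of lim u *)
Definition vnear (v : K -> int) (N : int) (a : K) (u : nat -> K) : Prop :=
  exists n0, forall n, (n0 <= n)%N -> vge v (a - u n) N.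

(* A point of prod_{v in Sigma} K_v is a family x : places -> (Cauchy sequences);
   it lies in prod_{v in Sigma} K_v^* iff every component is Cauchy and nonzero. *)
Definition in_prod_units (S : seq (K -> int)) (x : (K -> int) -> nat -> K) : Prop :=
  forall v, in_Sigma S v -> vcauchy v (x v) /\ ~ vnull v (x v).

(* x lies in the closure of the diagonal image of G in prod_{v in Sigma} K_v^*
   (product topology: basic neighbourhoods given by finitely many places T and
   a precision N). *)
Definition in_closure_diag (S : seq (K -> int)) (G : K -> Prop)
    (x : (K -> int) -> nat -> K) : Prop :=
  in_prod_units S x /\
  forall (T : seq (K -> int)) (N : int), (forall v, List.In v T -> in_Sigma S v) ->
    exists g, G g /\ forall v, List.In v T -> vnear v N g (x v).

Variable M : nat.

Definition on_W_prod (S : seq (K -> int)) (W : seq {mpoly K[M]})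
    (x : 'I_M -> (K -> int) -> nat -> K) : Prop :=
  (forall i, in_prod_units S (x i)) /\
  forall P, P \in W -> forall v, in_Sigma S v -> vnull v (fun n => P.@[fun i => x i v n]).

Definition W_of_closure (S : seq (K -> int)) (G : K -> Prop) (W : seq {mpoly K[M]})
    (x : 'I_M -> (K -> int) -> nat -> K) : Prop :=
  on_W_prod S W x /\ forall i, in_closure_diag S G (x i).

Definition closure_of_W (S : seq (K -> int)) (G : K -> Prop) (W : seq {mpoly K[M]})
    (x : 'I_M -> (K -> int) -> nat -> K) : Prop :=
  on_W_prod S W x /\
  forall (T : seq (K -> int)) (N : int), (forall v, List.In v T -> in_Sigma S v) ->
    exists g : 'I_M -> K,
      [/\ forall i, G (g i), forall P, P \in W -> P.@[g] = 0 &
          forall i v, List.In v T -> vnear v N (g i) (x i v)].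

End Defs.

(* Main.v *)
(** After translation, a point of the closure of Gamma lying on W gives approximations
    by tuples [gamma_i t^(a_i)], where [t] is a fixed S-unit generating [Gamma ∩ O_S^*]
    up to torsion; the equations of W become exponential sums
    [f(a) = sum_j c_j t^(L_j(a))], with integral linear forms [L_j], which are small at
    finitely many chosen places. Fix [m = m' p^e] and reduce the exponents modulo [m]: only
    finitely many sums arise, so finitely many places of Sigma detect whether
    [f / (t^m - 1)] is regular on Sigma up to the poles of the [c_j]. If it is, and the
    exponents leave a gap of length [G] on the circle [Z/m], then [f / (t^m - 1)] has poles
    bounded independently of [m'] and a zero of order about [G] at a pole of [t], so [f = 0].
    At a scale where the exponents split into well separated clusters on [Z/m], rotating each
    cluster above a gap shows that its sum vanishes by itself. The differences of exponents
    inside the clusters are bounded integers, so it remains to solve a linear system over [Z]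
    which is solvable modulo [m]; the Smith normal form gives an integral solution close
    to [a]. Since the prime-to-[p] part [m'] can be taken arbitrarily large with [e] fixed, the
    constants can be chosen consistently.

    The bound on zeros of functions with bounded poles needs enough places: a maximal
    subring of K containing [k[tau]] and [1/h] but not [h] is a discrete valuation ring, so an
    element without poles above [k[tau]] is integral over it, and Gauss's lemma bounds the
    coefficients of its minimal polynomial over [k(tau)]. *)

(* The form [m = m' p^e] reconciles two demands. The Smith normal form needs [m] divisible by a
   fixed integer, whose [p]-part is [p^e]. The pole bound needs [t^m - 1] to vanish to bounded order
   at the places of [S] where [t] is a unit; as [t^m - 1 = (t^m' - 1)^(p^e)] and the order of
   [t^m' - 1] is bounded over all [m'] prime to [p], this order is bounded for fixed [e]. So only
   [m'] may grow. The choices are then forced in this order: the divisor fixes [e], [e] fixes the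
   gap [G], [G] fixes the scales of the clusters, and the scales say how large [m'] has to be.

   Rank at most one turns each monomial into a single power of [t], so its exponent is a point on a
   circle and a gap can be rotated to one end. The exact solution is sought in the class of the
   approximate one modulo a period of [t] at the prescribed places and precision, which keeps it
   close to the given point.

   Finiteness of [k] enters twice: few polynomials have bounded degree, so zeros of functions with
   bounded poles are bounded; and residue fields are finite, so [t] has a period modulo every place
   where it is a unit. *)
Require Import Defs.
From HB Require Import structures.
From mathcomp Require Import all_boot all_order all_algebra all_field.
From mathcomp Require Import fraction.
From mathcomp Require Import mpoly.
From mathcomp Require Import zify ring.
From mathcomp Require boolp classical_sets generic_quotient.
Set Implicit Arguments. Unset Strict Implicit. Unset Printing Implicit Defensive.
Import Order.TTheory GRing.Theory Num.Theory.
Local Open Scope ring_scope.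

(* [lia] fails on contexts with hypotheses over [K], and it does not identify place values
   [v x] that differ only by canonical structure paths; these wrappers clear the former and
   abstract the latter up to conversion. *)
Ltac is_num x := let t := type of x in first [unify t int | unify t nat].
Ltac is_arith P :=
  lazymatch P with
  | @eq _ ?x _ => is_num x
  | is_true (leq _ _) => idtac
  | is_true (@Order.le _ _ ?x _) => is_num x
  | is_true (@Order.lt _ _ ?x _) => is_num x
  | is_true (_ == ?x) => is_num x
  | is_true (~~ ?b) => is_arith (is_true b)
  | is_true (?a && ?b) => is_arith (is_true a); is_arith (is_true b)
  | ~ (@eq _ ?x _) => is_num x
  | ?A \/ ?B => is_arith A; is_arith B
  | ?A /\ ?B => is_arith A; is_arith B
  end.
Ltac clear_nonarith :=
  repeat match goal with
  | H : ?P |- _ =>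
    lazymatch type of P with Prop => tryif is_arith P then fail else clear H end
  end.
Ltac abstract_places :=
  repeat match goal with H : ?P |- _ =>
    lazymatch type of P with Prop => revert H end end;
  repeat match goal with |- context [?v ?x] =>
    is_var v; lazymatch type of (v x) with int =>
      let a := fresh "a" in set a := (v x); clearbody a end end;
  intros.
Ltac plia := intros; clear_nonarith; abstract_places; lia.
Ltac pnia := intros; clear_nonarith; abstract_places; nia.

(** * Places and the Gauss lemma *)

Section Valuation.
Variables (F : fieldType) (K : fieldExtType F) (v : K -> int).
Hypothesis pv : is_place v.
Implicit Types (x y : K) (a b : int).

Lemma place0 : v 0 = 0. Proof. by case: pv. Qed.

Lemma placeM x y : x != 0 -> y != 0 -> v (x * y) = v x + v y.
Proof. by case: pv => _ + _ _; exact. Qed.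

Lemma place1 : v 1 = 0.
Proof. by have := placeM (oner_neq0 K) (oner_neq0 K); rewrite mulr1; plia. Qed.

Lemma placeN1 : v (-1) = 0.
Proof.
have n0 : (-1 : K) != 0 by rewrite oppr_eq0 oner_neq0.
by have := placeM n0 n0; rewrite mulrNN mulr1 place1; plia.
Qed.

Lemma placeN x : v (- x) = v x.
Proof.
have [->|x0] := eqVneq x 0; first by rewrite oppr0.
by rewrite -mulN1r placeM ?oppr_eq0 ?oner_neq0 // placeN1 add0r.
Qed.

Lemma placeV x : v x^-1 = - v x.
Proof.
have [->|x0] := eqVneq x 0; first by rewrite invr0 place0.
have := placeM x0 (_ : x^-1 != 0); rewrite invr_eq0 => /(_ x0).
by rewrite divff // place1; plia.
Qed.

Lemma placeX x (n : nat) : v (x ^+ n) = v x *+ n.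
Proof.
have [->|x0] := eqVneq x 0.
  by rewrite expr0n; case: n => [|n] /=; rewrite ?place1 // place0 mul0rn.
by elim: n => [|n IH]; rewrite ?expr0 ?place1 // exprS mulrS placeM ?expf_neq0 // IH.
Qed.

Lemma placeXz x (n : int) : v (x ^ n) = n * v x.
Proof.
case: n => n; rewrite ?NegzE -?exprnP ?exprnN ?placeX; first by plia.
by rewrite -exprnN placeV placeX; plia.
Qed.

Lemma vge0 a : vge v 0 a. Proof. by rewrite /vge eqxx. Qed.

Lemma vgeE x a : x != 0 -> vge v x a = (a <= v x).
Proof. by rewrite /vge => /negbTE ->. Qed.

Lemma vge_refl x : vge v x (v x).
Proof. by rewrite /vge lexx orbT. Qed.

Lemma vge_le a b x : b <= a -> vge v x a -> vge v x b.
Proof. by rewrite /vge => ab /orP[->//|/(le_trans ab) ->]; rewrite orbT. Qed.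

Lemma vgeN x a : vge v (- x) a = vge v x a.
Proof. by rewrite /vge oppr_eq0 placeN. Qed.

Lemma vgeD x y a : vge v x a -> vge v y a -> vge v (x + y) a.
Proof.
have [->|x0] := eqVneq x 0; first by rewrite add0r.
have [->|y0] := eqVneq y 0; first by rewrite addr0.
have [->|xy0] := eqVneq (x + y) 0; first by rewrite vge0.
rewrite !vgeE // => vx vy; case: pv => _ _ /(_ x y x0 y0 xy0) + _.
by apply: le_trans; rewrite le_min vx.
Qed.

Lemma vgeB x y a : vge v x a -> vge v y a -> vge v (x - y) a.
Proof. by move=> vx vy; apply: vgeD; rewrite ?vgeN. Qed.

Lemma vgeM x y a b : vge v x a -> vge v y b -> vge v (x * y) (a + b).
Proof.
have [->|x0] := eqVneq x 0; first by rewrite mul0r !vge0.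
have [->|y0] := eqVneq y 0; first by rewrite mulr0 !vge0.
by rewrite !vgeE ?mulf_neq0 // placeM //; apply: lerD.
Qed.

Lemma vge1 : vge v 1 0. Proof. by rewrite -place1 vge_refl. Qed.

Lemma vgeX x a (n : nat) : vge v x a -> vge v (x ^+ n) (a *+ n).
Proof.
move=> vx; elim: n => [|n IH]; first by rewrite expr0 mulr0n vge1.
by rewrite exprS mulrS vgeM.
Qed.

Lemma vgeMl x y a : x != 0 -> vge v (x * y) (v x + a) = vge v y a.
Proof.
move=> x0; have [->|y0] := eqVneq y 0; first by rewrite mulr0 !vge0.
by rewrite !vgeE ?mulf_neq0 // placeM // lerD2l.
Qed.

Lemma vge_sum (I : Type) (r : seq I) (P : pred I) (G : I -> K) a :
  (forall i, P i -> vge v (G i) a) -> vge v (\sum_(i <- r | P i) G i) a.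
Proof.
move=> H; apply: (big_ind (fun x => vge v x a)); rewrite ?vge0 //.
by move=> *; apply: vgeD.
Qed.

Lemma vge_near x y : vge v (x - y) (v y + 1) -> y != 0 -> x != 0 /\ v x = v y.
Proof.
move=> vxy y0; have [x0|x0] := eqVneq x 0.
  by move: vxy; rewrite x0 sub0r vgeN vgeE //; plia.
have vy_le : vge v x (v y).
  rewrite -[X in vge v X _](subrK y); apply: vgeD; last exact: vge_refl.
  by apply: vge_le vxy; plia.
have : vge v y (Num.min (v x) (v y + 1)).
  rewrite -[X in vge v X _](subKr x); apply: vgeB; last by apply: vge_le vxy; rewrite ge_min lexx orbT.
  by apply: (vge_le (a := v x)); rewrite ?vge_refl // ge_min lexx.
by move: vy_le; rewrite !vgeE // => ?; rewrite ge_min => /orP[]; split=> //; plia.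
Qed.

(** A Newton polygon estimate: if [v h < l], all lower terms of [P.[h]] have larger value than the
    leading one and the sum cannot vanish. For [l = 0] it says that the valuation ring is integrally
    closed. *)
Lemma monic_root_vge (P : {poly K}) (h : K) (l : int) : P \is monic -> root P h ->
  (forall i, (i < (size P).-1)%N -> vge v P`_i (l *+ ((size P).-1 - i))) ->
  vge v h l.
Proof.
move=> Pm /rootP; set n := (size P).-1 => Ph HP.
have sP : size P = n.+1 by rewrite prednK // lt0n size_poly_eq0 monic_neq0.
have [->|h0] := eqVneq h 0; first exact: vge0.
rewrite vgeE // leNgt; apply/negP => lt.
have := Ph; rewrite horner_coef sP big_ord_recr /= -[P`_n]/(lead_coef P) (monicP Pm).
rewrite mul1r addrC => /eqP; rewrite addr_eq0 => /eqP E.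
have : vge v (h ^+ n) (v h *+ n + 1).
  rewrite E vgeN; apply: vge_sum => i _.
  apply: vge_le (vgeM (HP _ (ltn_ord i)) (vgeX i (vge_refl h))).
  have lin := ltn_ord i.
  have -> : v h *+ n = v h *+ (n - i) + v h *+ i by rewrite -mulrnDr subnK // ltnW.
  have : v h *+ (n - i) < l *+ (n - i) by rewrite ltrMn2r lt subn_gt0 lin.
  by rewrite addrAC lerD2r; plia.
by rewrite vgeE ?expf_neq0 // placeX; plia.
Qed.

Lemma monic_root_vge0 (P : {poly K}) (h : K) : P \is monic -> root P h ->
  (forall i, vge v P`_i 0) -> vge v h 0.
Proof.
by move=> Pm Ph HP; apply: (monic_root_vge Pm Ph) => i _; rewrite mul0rn.
Qed.
End Valuation.

Section Gauss.
Variables (F : fieldType) (K : fieldExtType F) (v : K -> int).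
Hypothesis pv : is_place v.

(** [i0] is the first index where the weight attains its minimum [m]; strictness before [i0]
    isolates one term in a coefficient of a product, as in Gauss's lemma. *)
Lemma weighted_min (P : {poly K}) (l n : int) : P != 0 ->
  exists (m : int) (i0 : nat),
    [/\ P`_i0 != 0, v P`_i0 = l * (n - i0%:Z) + m,
        forall i, vge v P`_i (l * (n - i%:Z) + m)
      & forall i, (i < i0)%N -> vge v P`_i (l * (n - i%:Z) + m + 1)].
Proof.
move=> P0; pose w (i : nat) : int := v P`_i - l * (n - i%:Z).
have sP : (0 < size P)%N by rewrite lt0n size_poly_eq0.
have lP : ((size P).-1 < size P)%N by rewrite prednK.
pose o := Ordinal lP.
have oP : P`_o != 0 by rewrite -[P`_o]/(lead_coef P) lead_coef_eq0.
pose i1 := [arg min_(i < o | P`_i != 0) w i]%O.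
have [i1P minP] : P`_i1 != 0 /\ forall j : 'I_(size P), P`_j != 0 -> w i1 <= w j.
  by rewrite /i1; case: arg_minP => // i Pi Hi; split.
have wmin i : P`_i != 0 -> w i1 <= w i.
  move=> Pi; have lti : (i < size P)%N.
    by rewrite ltnNge; apply: contra Pi => /(nth_default 0) ->.
  exact: (minP (Ordinal lti)).
have ex : exists i, (P`_i != 0) && (w i == w i1) by exists i1; rewrite i1P eqxx.
case: (ex_minnP ex) => i0 /andP[Pi0 /eqP wi0] min0.
exists (w i1), i0; split=> //.
- by rewrite -wi0 /w; plia.
- move=> i; have [->|Pi] := eqVneq P`_i 0; first exact: vge0.
  by rewrite vgeE //; have := wmin i Pi; rewrite /w; plia.
move=> i lti; have [->|Pi] := eqVneq P`_i 0; first exact: vge0.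
rewrite vgeE //; have := wmin i Pi; have [E|] := eqVneq (w i) (w i1).
  by have := min0 i; rewrite Pi E eqxx => /(_ isT); rewrite leqNgt lti.
by rewrite /w; plia.
Qed.

(* The weight [min_i (v P_i - l (n - i))] is additive on products and nonpositive on monic
   polynomials. *)
Lemma monic_factor_vge (P Q : {poly K}) (l : int) : P \is monic -> Q \is monic ->
  (forall i, vge v (P * Q)`_i (l * ((size P).-1%:Z + (size Q).-1%:Z - i%:Z))) ->
  forall i, vge v P`_i (l * ((size P).-1%:Z - i%:Z)).
Proof.
move=> Pm Qm; set n : int := (size P).-1%:Z; set m : int := (size Q).-1%:Z => HPQ i.
have [a [i0 [Pi0 vP vPge vPgt]]] := weighted_min l n (monic_neq0 Pm).
have [b [j0 [Qj0 vQ vQge vQgt]]] := weighted_min l m (monic_neq0 Qm).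
suff a0 : 0 <= a by apply: vge_le (vPge i); plia.
have b0 : b <= 0.
  have := vQge (size Q).-1; rewrite -[Q`_ _]/(lead_coef Q) (monicP Qm).
  by rewrite vgeE ?oner_neq0 // place1 // -/m subrr mulr0 add0r.
rewrite leNgt; apply/negP => alt; set k := (i0 + j0)%N.
have lt0k : (i0 < k.+1)%N by rewrite ltnS leq_addr.
have := HPQ k; rewrite coefM (bigD1 (Ordinal lt0k)) //= => Hk.
have: vge v (P`_i0 * Q`_(k - i0)) (l * (n - i0%:Z) + a + (l * (m - j0%:Z) + b) + 1).
  rewrite -[X in vge v X _](addrK (\sum_(j < k.+1 | j != Ordinal lt0k) P`_j * Q`_(k - j))).
  apply: vgeB => //.
    apply: vge_le Hk; rewrite /k PoszD.
    have -> : l * (n - i0%:Z) + a + (l * (m - j0%:Z) + b) + 1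
      = l * (n + m - (i0%:Z + j0%:Z)) + (a + b + 1) by ring.
    by plia.
  (* Any other term has its first index below [i0] or its second below [j0], so one of its two
     weights is strictly above the minimum. *)
  apply: vge_sum => // j /eqP nj; have ltj := ltn_ord j.
  have eqk : (k - j)%N%:Z = i0%:Z + j0%:Z - j%:Z by rewrite -subzn ?PoszD // -ltnS.
  have [lt|ge] := ltnP j i0.
    apply: vge_le (vgeM pv (vPgt _ lt) (vQge (k - j)%N)).
    by rewrite eqk le_eqVlt; apply/orP; left; apply/eqP; ring.
  have lt : (k - j < j0)%N.
    have kE : k = (i0 + j0)%N by [].
    have : (j : nat) <> i0 by move=> E; apply: nj; apply: val_inj.
    by plia.
  apply: vge_le (vgeM pv (vPge j) (vQgt _ lt)).
  by rewrite eqk le_eqVlt; apply/orP; left; apply/eqP; ring.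
have -> : (k - i0 = j0)%N by rewrite /k addKn.
by rewrite vgeE ?mulf_neq0 // placeM // vP vQ; plia.
Qed.
End Gauss.

(** * Existence of places *)

Section Subrings.
Variables (F : fieldType) (K : fieldExtType F).
Implicit Types (x y h : K) (R : K -> Prop).

Definition is_subring R : Prop :=
  [/\ R 1, forall x y, R x -> R y -> R (x - y) & forall x y, R x -> R y -> R (x * y)].

Section Closure.
Variable R : K -> Prop.
Hypothesis subR : is_subring R.

Lemma subring1 : R 1. Proof. by case: subR. Qed.
Lemma subringB x y : R x -> R y -> R (x - y). Proof. by case: subR => _ + _; exact. Qed.
Lemma subringM x y : R x -> R y -> R (x * y). Proof. by case: subR => _ _; exact. Qed.
Lemma subring0 : R 0. Proof. by rewrite -(subrr 1); apply: subringB subring1 subring1. Qed.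
Lemma subringN x : R x -> R (- x).
Proof. by rewrite -sub0r; apply: subringB; exact: subring0. Qed.
Lemma subringD x y : R x -> R y -> R (x + y).
Proof. by move=> Rx Ry; rewrite -[y]opprK; apply: subringB => //; apply: subringN. Qed.
Lemma subringX x n : R x -> R (x ^+ n).
Proof.
by move=> Rx; elim: n => [|n IH]; rewrite ?expr0 ?exprS; [exact: subring1|exact: subringM].
Qed.
Lemma subring_sum (I : Type) (r : seq I) (P : pred I) (G : I -> K) :
  (forall i, P i -> R (G i)) -> R (\sum_(i <- r | P i) G i).
Proof. by move=> H; apply: (big_ind R) => //; [exact: subring0 | exact: subringD]. Qed.
Lemma subring_horner (P : {poly K}) x : (forall i, R P`_i) -> R x -> R P.[x].
Proof.
move=> RP Rx; rewrite horner_coef; apply: subring_sum => i _.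
by apply: subringM => //; apply: subringX.
Qed.
End Closure.

Lemma max_subring A h : is_subring A -> ~ A h ->
  exists R, [/\ is_subring R, forall x, A x -> R x, ~ R h &
    forall R', is_subring R' -> (forall x, R x -> R' x) -> ~ R' h ->
      forall x, R' x -> R x].
Proof.
move=> subA Ah.
(* The empty set is allowed so that the union of the empty chain is covered. *)
pose P (X : classical_sets.set K) :=
  (forall x, ~ X x) \/ [/\ is_subring X, forall x, A x -> X x & ~ X h].
have [C CP Ctot|R [PR maxR]] := @classical_sets.Zorn_bigcup K P.
  have [[X [CX [x0 Xx0]]]|none] := boolp.EM (exists X, C X /\ exists x, X x); last first.
    by left=> x [X CX Xx]; apply: none; exists X; split=> //; exists x.
  have good Y y : C Y -> Y y -> [/\ is_subring Y, forall x, A x -> Y x & ~ Y h].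
    by move=> CY Yy; case: (CP Y CY) => // /(_ y).
  right; split; first split.
  - by exists X => //; have [/subring1] := good _ _ CX Xx0.
  - move=> x y [Y CY Yx] [Z CZ Zy].
    have [sY _ _] := good _ _ CY Yx; have [sZ _ _] := good _ _ CZ Zy.
    have [YZ|ZY] := Ctot _ _ CY CZ.
      by exists Z => //; apply: subringB => //; apply: YZ.
    by exists Y => //; apply: subringB => //; apply: ZY.
  - move=> x y [Y CY Yx] [Z CZ Zy].
    have [sY _ _] := good _ _ CY Yx; have [sZ _ _] := good _ _ CZ Zy.
    have [YZ|ZY] := Ctot _ _ CY CZ.
      by exists Z => //; apply: subringM => //; apply: YZ.
    by exists Y => //; apply: subringM => //; apply: ZY.
  - by move=> x Ax; exists X => //; have [_ AX _] := good _ _ CX Xx0; apply: AX.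
  - by move=> [Y CY Yh]; have [_ _] := good _ _ CY Yh.
case: PR => [R0|[subR AR Rh]].
  case: (maxR A); last by right.
  split; first by move=> x /R0.
  by move=> /(_ 1 (subring1 subA)) /R0.
exists R; split=> // R' subR' RR' R'h.
apply: boolp.contrapT => nR'R; apply: (maxR R'); last first.
  by right; split=> // x /AR /RR'.
by split=> // R'R; apply: nR'R => x; apply: R'R.
Qed.

(** If neither [x] nor [x^-1] is in [R], maximality puts [h] in both [R[x]] and [R[x^-1]].
    Multiplied by [y = h^-1], this writes 1 in two ways; each relation shortens the other, down to
    length one, which would put [h] in [R]. *)
Lemma max_subring_valuation R h : is_subring R -> R h^-1 -> ~ R h ->
  (forall R', is_subring R' -> (forall x, R x -> R' x) -> ~ R' h ->
      forall x, R' x -> R x) ->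
  forall x, x != 0 -> R x \/ R x^-1.
Proof.
move=> subR Ry Rh maxR.
have h0 : h != 0 by apply/eqP => h0; apply: Rh; rewrite h0; apply: subring0.
set y := h^-1 in Ry.
pose Rel x n := exists2 a : nat -> K, forall i, R (a i) & y * \sum_(i < n) a i * x ^+ i = 1.
have RelP x : ~ R x -> exists n, forall m, (n <= m)%N -> Rel x m.
  move=> nRx; pose R' z := exists2 P : {poly K}, forall i, R P`_i & z = P.[x].
  have subR' : is_subring R'.
    split.
    - exists 1; last by rewrite hornerE.
      by move=> i; rewrite coef1; case: (i == 0)%N; [apply: subring1|apply: subring0].
    - move=> _ _ [P RP ->] [Q RQ ->]; exists (P - Q); last by rewrite !hornerE.
      by move=> i; rewrite coefB; apply: subringB.
    - move=> _ _ [P RP ->] [Q RQ ->]; exists (P * Q); last by rewrite !hornerE.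
      by move=> i; rewrite coefM; apply: subring_sum => // j _; apply: subringM.
  have [[P RP hP]|nh] := boolp.EM (R' h); last first.
    case: nRx; apply: (maxR R') => //.
      move=> z Rz; exists z%:P; rewrite ?hornerC // => i; rewrite coefC.
      by case: (i == 0)%N => //; apply: subring0.
    exists 'X; last by rewrite hornerX.
    by move=> i; rewrite coefX; case: (i == 1)%N; [apply: subring1|apply: subring0].
  exists (size P) => m le; exists (fun i => P`_i) => //.
  by rewrite -horner_coef_wide // -hP /y mulVf.
have step x n : x != 0 -> (0 < n)%N -> Rel x n.+1 -> Rel x^-1 n.+1 -> Rel x n.
  move=> x0 n0 [a Ra Ea] [b Rb Eb].
  (* The relation for [x^-1], multiplied by [x ^+ n], expresses [x ^+ n * (1 - y * b 0)] by lower
     powers of [x]. *)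
  have Eb' : x ^+ n * (1 - y * b 0%N) = y * \sum_(i < n) b (n - i)%N * x ^+ i.
    rewrite -{1}Eb -mulrBr mulrCA; congr (_ * _).
    rewrite big_ord_recl expr0 mulr1 /= addrAC subrr add0r mulr_sumr.
    rewrite (reindex_inj rev_ord_inj); apply: eq_bigr => i _ /=.
    have lin := ltn_ord i.
    have -> : bump 0 (n - i.+1) = (n - i)%N by rewrite /bump /=; lia.
    rewrite mulrCA exprVn; congr (_ * _).
    by rewrite -{1}(subnK (ltnW lin)) exprD mulrAC mulfV ?mul1r // expf_neq0.
  (* These come from [1 = (1 - y * b 0) * 1 + y * b 0]: the relation for [x] replaces the factor 1,
     and [Eb'] rewrites its top term. *)
  exists (fun i => (1 - y * b 0%N) * a i + a n * y * b (n - i)%N + (i == 0)%N%:R * b 0%N).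
    move=> i; have R1 := subring1 subR; have R0 := subring0 subR.
    apply: subringD => //; last by apply: subringM => //; case: (i == _).
    apply: subringD => //; apply: subringM => //; last exact: subringM.
    by apply: subringB => //; apply: subringM.
  under eq_bigr do rewrite mulrDl mulrDl.
  rewrite !big_split /=.
  have -> : \sum_(i < n) (i == 0 :> nat)%:R * b 0%N * x ^+ i = b 0%N.
    case: n n0 {Ea Eb Eb'} => // n _; rewrite big_ord_recl /= mul1r expr0 mulr1.
    by rewrite big1 ?addr0 // => i _; rewrite !mul0r.
  have -> : \sum_(i < n) a n * y * b (n - i)%N * x ^+ i = a n * (x ^+ n * (1 - y * b 0%N)).
    by rewrite Eb' mulrA mulr_sumr; apply: eq_bigr => i _; rewrite !mulrA.
  have -> : \sum_(i < n) (1 - y * b 0%N) * a i * x ^+ i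
     = (1 - y * b 0%N) * \sum_(i < n) a i * x ^+ i.
    by rewrite mulr_sumr; apply: eq_bigr => i _; rewrite !mulrA.
  move: Ea; rewrite big_ord_recr /=; set s := \sum_(i < n) a i * x ^+ i => Ea.
  have -> : (1 - y * b 0%N) * s + a n * (x ^+ n * (1 - y * b 0%N)) + b 0%N
     = (1 - y * b 0%N) * (s + a n * x ^+ n) + b 0%N by ring.
  by rewrite mulrDr mulrCA Ea mulr1 addrNK.
have base x : ~ Rel x 1%N.
  move=> [a Ra]; rewrite big_ord1 expr0 mulr1 => E; apply: Rh.
  suff -> : h = a 0%N by [].
  by apply: (mulfI (x := y)); rewrite ?invr_eq0 // E /y mulVf.
have no n x : x != 0 -> Rel x n.+1 -> Rel x^-1 n.+1 -> False.
  elim: n x => [|n IH] x x0 H1 H2; first exact: base H1.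
  apply: (IH x) => //; first exact: step H1 H2.
  by apply: step => //; rewrite ?invr_eq0 // invrK.
move=> x x0; apply: boolp.contrapT => /boolp.not_orP[nx nx'].
have [n Hn] := RelP x nx; have [m Hm] := RelP _ nx'.
by apply: (no (n + m)%N x) => //; [apply: Hn|apply: Hm]; lia.
Qed.
End Subrings.

(** * Rational coordinates and valuation rings above [k[tau]] *)

Section Evaluation.
Variables (k : finFieldType) (F : fieldType) (K : fieldExtType F).
Variable iota : {rmorphism k -> K}.

Definition ev (tau : K) (A : {poly k}) : K := (map_poly iota A).[tau].

Fact ev_zmod_morphism tau : zmod_morphism (ev tau).
Proof. by move=> A B; rewrite /ev rmorphB !hornerE. Qed.

Fact ev_monoid_morphism tau : monoid_morphism (ev tau).
Proof. by split=> [|A B]; rewrite /ev ?rmorph1 ?rmorphM !hornerE. Qed.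

HB.instance Definition _ tau :=
  GRing.isZmodMorphism.Build {poly k} K (ev tau) (@ev_zmod_morphism tau).
HB.instance Definition _ tau :=
  GRing.isMonoidMorphism.Build {poly k} K (ev tau) (@ev_monoid_morphism tau).

Lemma evC tau c : ev tau c%:P = iota c.
Proof. by rewrite /ev map_polyC hornerC. Qed.

Lemma evX tau : ev tau 'X = tau.
Proof. by rewrite /ev map_polyX hornerX. Qed.

Lemma ev_subring (R : K -> Prop) tau A :
  is_subring R -> (forall c, R (iota c)) -> R tau -> R (ev tau A).
Proof.
by move=> subR Rc Rt; apply: subring_horner => // i; rewrite coef_map; apply: Rc.
Qed.

(** The base field, seen in [K] as [1%VS], is the rational function field [k(tau)]. With [tau]
    variable, [T] and [T^-1] can exchange roles, so the poles of [T] become finite places. *)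
Definition ratgen (tau : K) : Prop :=
  (forall A, ev tau A = 0 -> A = 0) /\
  (forall x, x \in 1%VS <-> exists A B, B != 0 /\ x = ev tau A / ev tau B).

Definition integral_ev (tau h : K) : Prop :=
  exists2 G : {poly {poly k}}, G \is monic & root (map_poly (ev tau) G) h.

Lemma ratgen_ev tau A : ratgen tau -> ev tau A \in 1%VS.
Proof.
by move=> [_ H]; apply/H; exists A, 1; split; rewrite ?oner_neq0 // rmorph1 divr1.
Qed.

Lemma nonintegral_valuation_ring tau h : ~ integral_ev tau h ->
  exists R, [/\ is_subring R, forall A, R (ev tau A), ~ R h
              & forall x, x != 0 -> R x \/ R x^-1].
Proof.
move=> nint.
have h0 : h != 0.
  by apply/eqP => h0; apply: nint; exists 'X; rewrite ?monicX // map_polyX /root hornerX h0.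
(* [A] is the ring [k[tau][h^-1]]; if it contained [h], clearing denominators would give a monic
   equation for [h] of degree [n + 1]. *)
pose A x := exists n, exists2 G : {poly {poly k}},
  (size G <= n.+1)%N & x * h ^+ n = (map_poly (ev tau) G).[h].
have szX (G : {poly {poly k}}) n m : (size G <= n.+1)%N -> (size (G * 'X^m)%R <= (n + m).+1)%N.
  by move=> le; apply: (leq_trans (size_polyMleq _ _)); rewrite size_polyXn; lia.
have subA : is_subring A.
  split.
  - by exists 0%N, 1; rewrite ?size_poly1 // rmorph1 !hornerE.
  - move=> x y [n [G sG EG]] [m [H sH EH]]; exists (n + m)%N, (G * 'X^m - H * 'X^n).
      apply: (leq_trans (size_polyD _ _)); rewrite size_polyN geq_max szX //.
      by rewrite addnC szX.
    rewrite rmorphB !rmorphM /= !map_polyXn !hornerE -EG -EH.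
    by rewrite mulrBl exprD; ring.
  - move=> x y [n [G sG EG]] [m [H sH EH]]; exists (n + m)%N, (G * H).
      by apply: (leq_trans (size_polyMleq _ _)); lia.
    by rewrite rmorphM !hornerE -EG -EH exprD; ring.
have Ah : ~ A h.
  move=> [n [G sG EG]]; apply: nint; exists ('X^(n.+1) - G).
    rewrite monicE lead_coefDl ?lead_coefXn // size_polyXn size_polyN ltnS.
    exact: sG.
  by rewrite rmorphB /= map_polyXn /root !hornerE -EG exprS subrr.
have [R [subR AR Rh maxR]] := max_subring subA Ah.
exists R; split=> //.
- move=> B; apply: AR; exists 0%N, B%:P; first by rewrite size_polyC; case: (_ == _).
  by rewrite map_polyC hornerC expr0 mulr1.
- apply: (max_subring_valuation subR _ Rh maxR); apply: AR; exists 1%N, 1.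
    by rewrite size_poly1.
  by rewrite rmorph1 hornerC expr1 mulVf.
Qed.
End Evaluation.

Lemma minPoly_relation (F : fieldType) (K : fieldExtType F) (x : K) : exists2 r, (r <= \dim {:K})%N &
  [/\ (0 < r)%N, minPoly 1%AS x \is monic, size (minPoly 1%AS x) = r.+1,
      forall i, (minPoly 1%AS x)`_i \in 1%VS
    & x ^+ r + \sum_(i < r) (minPoly 1%AS x)`_i * x ^+ i = 0].
Proof.
exists (adjoin_degree 1%AS x).
  rewrite /adjoin_degree prednK ?dimv1 ?divn1 ?adim_gt0 //.
  by rewrite dimvS // subvf.
split; rewrite ?monic_minPoly ?size_minPoly //.
  by move=> i; have /polyOverP := minPolyOver 1%AS x; apply.
have := root_minPoly 1%AS x; rewrite /root horner_coef size_minPoly big_ord_recr /=.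
have := monic_minPoly 1%AS x; rewrite monicE /lead_coef size_minPoly /= => /eqP ->.
by rewrite mul1r addrC => /eqP.
Qed.

Section PlaceOfRing.
Variables (k : finFieldType) (F : fieldType) (K : fieldExtType F).
Variable iota : {rmorphism k -> K}.
Variables (tau h : K) (R : K -> Prop).
Hypothesis gen : ratgen iota tau.
Hypothesis subR : is_subring R.
Hypothesis Rev : forall A, R (ev iota tau A).
Hypothesis Rh : ~ R h.
Hypothesis Rval : forall x, x != 0 -> R x \/ R x^-1.
Implicit Types x y : K.

Local Notation evt := (ev iota tau).
Let unitR x := R x /\ R x^-1.
Let nonunit x := x = 0 \/ ~ R x^-1.

Let nonunitM x y : R x -> nonunit y -> nonunit (x * y).
Proof.
move=> Rx [->|Ry]; first by left; rewrite mulr0.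
have [x0|x0] := eqVneq x 0; first by left; rewrite x0 mul0r.
right=> Rxy; apply: Ry; have := subringM subR Rx Rxy.
by rewrite invfM mulrA divff // mul1r.
Qed.

Let nonunitD x y : nonunit x -> nonunit y -> nonunit (x + y).
Proof.
move=> nx ny; have [->|x0] := eqVneq x 0; first by rewrite add0r.
have [->|y0] := eqVneq y 0; first by rewrite addr0.
have R1 := subring1 subR.
have [Rxy|] := Rval (mulf_neq0 x0 (invr_neq0 y0)).
  have -> : x + y = (x / y + 1) * y by rewrite mulrDl mul1r divfK.
  by apply: nonunitM => //; apply: subringD.
rewrite invf_div => Ryx.
have -> : x + y = (y / x + 1) * x by rewrite mulrDl mul1r divfK // addrC.
by apply: nonunitM => //; apply: subringD.
Qed.

Let nonunit1 : ~ nonunit 1.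
Proof. by case=> [/eqP|]; rewrite ?oner_eq0 ?invr1 // => /(_ (subring1 subR)). Qed.

Let unitRM x y : unitR x -> unitR y -> unitR (x * y).
Proof. by move=> [? ?] [? ?]; split; rewrite ?invfM; apply: subringM. Qed.

Let unitRV x : unitR x -> unitR x^-1.
Proof. by case; split; rewrite ?invrK. Qed.

Let unitR1 : unitR 1.
Proof. by split; rewrite ?invr1; apply: subring1. Qed.

Let unitRX x n : unitR x -> unitR (x ^+ n).
Proof. by move=> ux; elim: n => [|n IH]; rewrite ?expr0 // exprS; apply: unitRM. Qed.

(** Otherwise [R] contains the base field. As [h^-1] lies in [R] and [h] is algebraic, dividing the
    minimal equation by a power of [h] writes [h] as a polynomial in [h^-1] over [R], against
    [Rh]. *)
Let exists_nonunit_ev : exists A, evt A != 0 /\ nonunit (evt A).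
Proof.
apply: boolp.contrapT => no; apply: Rh.
have RF x : x \in 1%VS -> R x.
  case: gen => _ /[apply] -[A [B [B0 ->]]]; apply: subringM => //.
  apply: boolp.contrapT => RB; apply: no; exists B; split; last by right.
  by apply/eqP => /(proj1 gen) BB; rewrite BB eqxx in B0.
have [->|h0] := eqVneq h 0; first exact: subring0.
have [r _ [r0 _ _ cF E]] := minPoly_relation h.
have Rhv : R h^-1 by case: (Rval h0).
have -> : h = - \sum_(i < r) (minPoly 1%AS h)`_i * h^-1 ^+ (r.-1 - i).
  apply: (mulIf (expf_neq0 r.-1 h0)); rewrite -exprS prednK // mulNr mulr_suml.
  apply/eqP; rewrite -addr_eq0 -[X in _ == X]E; apply/eqP; congr (_ + _).
  apply: eq_bigr => i _; rewrite -mulrA; congr (_ * _).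
  have le : (i <= r.-1)%N by have := ltn_ord i; lia.
  by rewrite -{2}(subnK le) exprD mulrA exprVn mulVf ?mul1r // expf_neq0.
apply: subringN => //; apply: subring_sum => // i _.
by apply: subringM => //; [apply: RF | apply: subringX].
Qed.

(** By Euclidean division a nonzero nonunit of least size divides every nonunit of [k[tau]], and the
    quotient has smaller size. *)
Let exists_generator : exists P, [/\ P != 0, nonunit (evt P)
  & forall A, A != 0 -> exists n, exists2 u, evt A = evt P ^+ n * u & unitR u].
Proof.
have ex : exists n, boolp.asbool (exists A : {poly k}, [/\ size A = n, A != 0 & nonunit (evt A)]).
  have [A [A0 nA]] := exists_nonunit_ev; exists (size A); apply/boolp.asboolP.
  by exists A; split=> //; apply: contraNneq A0 => ->; rewrite rmorph0.
case: (ex_minnP ex) => n /boolp.asboolP [P [sP P0 nP]] minn.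
exists P; split=> // A.
move: {2}(size A).+1 (ltnSn (size A)) => m; elim: m A => // m IH A ltm A0.
have evA0 : evt A != 0 by apply: contraNneq A0 => /(proj1 gen) ->.
have [RA|nRA] := boolp.EM (R (evt A)^-1).
  by exists 0%N, (evt A); rewrite ?expr0 ?mul1r; split.
have E : A = A %/ P * P + A %% P := divp_eq A P.
have modP0 : A %% P = 0.
  apply/eqP; apply: boolp.contrapT => /negP r0.
  have : nonunit (evt (A %% P)).
    have -> : A %% P = A + (- (A %/ P)) * P by rewrite {2}E; ring.
    rewrite rmorphD rmorphM; apply: nonunitD; first by right.
    by apply: nonunitM => //; apply: Rev.
  move=> nr; have : (n <= size (A %% P)%R)%N.
    by apply: minn; apply/boolp.asboolP; exists (A %% P).
  by rewrite -sP leqNgt ltn_modp P0.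
rewrite modP0 addr0 in E.
have Q0 : A %/ P != 0 by apply: contraNneq A0 => Q0; rewrite E Q0 mul0r.
have sP1 : (1 < size P)%N.
  rewrite ltnNge; apply/negP => /size1_polyC PC.
  have P00 : P`_0 != 0 by apply: contraNneq P0 => c0; rewrite PC c0.
  case: nP => [|RP]; first by move=> /(proj1 gen) /eqP; apply/negP.
  apply: RP; have <- : evt (P`_0)^-1%:P = (evt P)^-1 by rewrite {2}PC !evC fmorphV.
  exact: Rev.
have ltQ : (size (A %/ P)%R < m)%N.
  have le : (size P <= size A)%N by apply: dvdp_leq => //; rewrite E dvdp_mulIr.
  rewrite size_divp //; move: ltm le sP1; move: (size A) (size P) => a b; lia.
have [j [u Eu uu]] := IH _ ltQ Q0.
by exists j.+1, u => //; rewrite {1}E rmorphM /= Eu exprS; ring.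
Qed.

Lemma ring_place : exists v, [/\ is_place v, forall x, R x -> vge v x 0 & ~~ vge v h 0].
Proof.
have [P [P0 nP genP]] := exists_generator.
have evP0 : evt P != 0 by apply: contraNneq P0 => /(proj1 gen) ->.
set rho := evt P in evP0 genP nP.
have rhoX0 (n : int) : rho ^ n != 0 by rewrite expfz_neq0.
(* [vrel x e] says that [x] has the value of [rho ^ e]. Because of ramification such an [e] need not
   exist for [x] itself, only for a power of [x]. *)
pose vrel x (e : int) := unitR (x / rho ^ e).
have vrelM x y a b : vrel x a -> vrel y b -> vrel (x * y) (a + b).
  move=> vx vy; rewrite /vrel expfzDr // invfM mulrACA; exact: unitRM.
have vrelV x a : vrel x a -> vrel x^-1 (- a).
  by move=> /unitRV; rewrite /vrel invfM invrK invr_expz opprK.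
have vrelX x a n : vrel x a -> vrel (x ^+ n) (a *+ n).
  move=> vx; elim: n => [|n IH]; last by rewrite exprS mulrS; apply: vrelM.
  by rewrite /vrel expr0 mulr0n expr0z divr1; apply: unitR1.
have Rrho (n : nat) : (0 < n)%N -> nonunit (rho ^+ n).
  case: n => // n _; rewrite exprS mulrC; apply: nonunitM => //.
  by apply: subringX => //; apply: Rev.
have unit_nonunit x : x != 0 -> unitR x -> ~ nonunit x.
  by move=> x0 [_ Rx'] /(nonunitM Rx'); rewrite mulVf.
have unit_rho n : unitR (rho ^ n) -> n = 0.
  case: n => [[|n]|n] //; first by move=> /(unit_nonunit _ (rhoX0 _)) []; apply: Rrho.
  by rewrite NegzE -invr_expz => /unitRV; rewrite invrK => /(unit_nonunit _ (rhoX0 n.+1)) []; apply: Rrho.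
have vrel_uniq x a b : x != 0 -> vrel x a -> vrel x b -> a = b.
  move=> x0 va vb; have := vrelM _ _ _ _ va (vrelV _ _ vb).
  rewrite mulfV // => /unitRV; rewrite div1r invrK => /unit_rho; lia.
have vrelF x : x \in 1%VS -> x != 0 -> exists e, vrel x e.
  case: gen => _ /[apply] -[A [B [B0 ->]]] AB0.
  have A0 : A != 0 by apply: contraNneq AB0 => ->; rewrite rmorph0 mul0r.
  have [n [u Eu uu]] := genP _ A0; have [m [w Ew uw]] := genP _ B0.
  exists (n%:Z - m%:Z); apply: vrelM.
    by rewrite /vrel Eu mulrAC mulfV ?mul1r ?expf_neq0.
  by apply: vrelV; rewrite /vrel Ew mulrAC mulfV ?mul1r ?expf_neq0.
(* Two terms of the minimal equation of [x] share the least value, so [x ^+ (j - i)] has the value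
   of an element of the base field for some [0 < j - i <= \dim {:K}]; the factorial is a common
   multiple of these exponents. *)
pose D := (\dim {:K})`!.
have vrelK x : x != 0 -> exists e, vrel (x ^+ D) e.
  move=> x0; have [r ler [r0 mon sz cF E]] := minPoly_relation x.
  set mu := minPoly 1%AS x in mon sz cF E.
  pose T (i : 'I_r.+1) := mu`_i * x ^+ i.
  have lastT : T ord_max != 0.
    rewrite /T mulf_neq0 ?expf_neq0 //=.
    by have := monicP mon; rewrite /lead_coef sz /= => ->; rewrite oner_neq0.
  have sumT : \sum_i T i = 0.
    rewrite big_ord_recr /= /T /=; have := monicP mon; rewrite /lead_coef sz /= => ->.
    by rewrite mul1r addrC; apply: E.
  have total a b : a != 0 -> b != 0 -> R (a / b) \/ R (b / a).
    by move=> a0 b0; rewrite -(invf_div a b); apply: Rval; rewrite mulf_neq0 ?invr_eq0.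
  have [i0 T0 maxi0] : exists2 i0, T i0 != 0 & forall i, R (T i / T i0).
    suff H (s : seq 'I_r.+1) : exists2 i0, T i0 != 0 & forall i, i \in s -> R (T i / T i0).
      by have [i0 T0 H0] := H (enum 'I_r.+1); exists i0 => // i; apply: H0; rewrite mem_enum.
    elim: s => [|i s [i0 T0 H0]]; first by exists ord_max.
    have [Ti0|Ti] := eqVneq (T i) 0.
      exists i0 => // j; rewrite inE => /orP[/eqP->|]; last exact: H0.
      by rewrite Ti0 mul0r; apply: subring0.
    have [le|le] := total _ _ Ti T0.
      by exists i0 => // j; rewrite inE => /orP[/eqP->|//]; last exact: H0.
    exists i => // j; rewrite inE => /orP[/eqP->|/H0 Hj].
      by rewrite mulfV //; apply: subring1.
    by rewrite -(divfK T0 (T j)) -[X in R X]mulrA; apply: subringM.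
  (* Were the least value attained only at [i0], dividing the equation by [T i0] would make 1 a sum
     of nonunits. *)
  have [i1 ne1 [T1 u1]] : exists2 i1, i1 != i0 & T i1 != 0 /\ unitR (T i1 / T i0).
    apply: boolp.contrapT => no; apply: nonunit1.
    have -> : 1 = - \sum_(i | i != i0) T i / T i0.
      apply/eqP; rewrite -addr_eq0 -{1}(mulfV T0) -mulr_suml -mulrDl.
      by rewrite -(bigD1 i0 (P := predT) (F := T)) // sumT mul0r.
    have nonunit0 : nonunit 0 by left.
    rewrite -mulN1r; apply: nonunitM.
      by apply: subringN => //; apply: subring1.
    apply: (big_ind nonunit) => [//|a b|i ne]; first exact: nonunitD.
    have [->|Ti] := eqVneq (T i) 0; first by rewrite mul0r.
    by right=> Rinv; apply: no; exists i => //; split=> //; split.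
  have nz i : T i != 0 -> mu`_i != 0 by apply: contraNneq => E0; rewrite /T E0 mul0r.
  have [a1 va1] := vrelF _ (cF i1) (nz _ T1).
  have [a0 va0] := vrelF _ (cF i0) (nz _ T0).
  have key (i j : 'I_r.+1) a b : (i < j)%N -> vrel mu`_i a -> vrel mu`_j b ->
      mu`_i != 0 -> mu`_j != 0 -> unitR (T i / T j) -> exists e, vrel (x ^+ D) e.
    move=> lt va vb mi mj uij.
    have : vrel (x ^+ (j - i)) (a - b).
      have -> : x ^+ (j - i) = (T i / T j)^-1 * (mu`_i / mu`_j).
        have Ej : x ^+ j = x ^+ (j - i) * x ^+ i by rewrite -exprD subnK // ltnW.
        by rewrite /T Ej; field; rewrite mi mj !expf_neq0.
      rewrite -[a - b]add0r; apply: (vrelM); last by apply: (vrelM) => //; apply: vrelV.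
      by rewrite /vrel expr0z divr1; apply: unitRV.
    move=> vji; have dv : (j - i %| D)%N.
      by apply: dvdn_fact; have := ltn_ord j; lia.
    by exists ((a - b) *+ (D %/ (j - i))); rewrite -{1}(divnK dv) mulnC exprM; apply: (vrelX).
  case: (ltngtP i0 i1) => [lt|lt|E01].
  - by apply: (key _ _ _ _ lt va0 va1); rewrite ?nz // -invf_div; apply: unitRV.
  - by apply: (key _ _ _ _ lt va1 va0); rewrite ?nz.
  - by case/eqP: ne1; apply: val_inj.
have [phi Hphi] : exists phi : K -> int, forall x, x != 0 -> vrel (x ^+ D) (phi x).
  suff /boolp.choice[f Hf] : forall x, exists e, x != 0 -> vrel (x ^+ D) e by exists f.
  by move=> x; have [->|/vrelK[e He]] := eqVneq x 0; [exists 0|exists e].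
have D0 : (0 < D)%N := fact_gt0 _.
have phiM x y : x != 0 -> y != 0 -> phi (x * y) = phi x + phi y.
  move=> x0 y0; have xy0 := mulf_neq0 x0 y0.
  apply: (vrel_uniq ((x * y) ^+ D)); rewrite ?expf_neq0 //; first exact: Hphi.
  by rewrite exprMn; apply: vrelM; apply: Hphi.
have phi1 : phi 1 = 0.
  by have := phiM 1 1 (oner_neq0 K) (oner_neq0 K); rewrite mulr1; plia.
have phiV x : x != 0 -> phi x^-1 = - phi x.
  by move=> x0; have := phiM x x^-1 x0 (invr_neq0 x0); rewrite mulfV // phi1; plia.
have phiX x (n : nat) : x != 0 -> phi (x ^+ n) = phi x *+ n.
  move=> x0; elim: n => [|n IH]; first by rewrite expr0 phi1.
  by rewrite exprS mulrS phiM ?expf_neq0 // IH.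
have phiXz x (n : int) : x != 0 -> phi (x ^ n) = n * phi x.
  move=> x0; case: n => n; rewrite ?NegzE -?exprnP ?exprnN; first by rewrite phiX //; plia.
  by rewrite -exprnN phiV ?expf_neq0 // phiX //; plia.
have phi_ge0 x : x != 0 -> (0 <= phi x) <-> R x.
  have RX y n : R y -> R (y ^+ n) by exact: subringX.
  have pos y : y != 0 -> 0 <= phi y -> R y.
    move=> y0 ge; have [//|Ry] := Rval y0; apply: boolp.contrapT => nRy.
    have : R (y ^+ D).
      have := Hphi y y0; case: (phi y) ge => // n _ [+ _].
      move=> /(subringM subR (RX rho n (Rev P))).
      by rewrite mulrC divfK.
    move=> RyD; apply: nonunit1; rewrite -(divff (expf_neq0 D y0)).
    apply: nonunitM => //; right; rewrite invrK => Ry'.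
    apply: nRy; rewrite -[y]mul1r -(divff (expf_neq0 D.-1 y0)).
    have -> : y ^+ D.-1 / y ^+ D.-1 * y = y ^+ D * y^-1 ^+ D.-1.
      by rewrite exprVn mulrAC -exprSr prednK.
    by apply: subringM => //; apply: RX.
  move=> x0; split; first exact: pos.
  move=> Rx; rewrite leNgt; apply/negP => lt.
  have Rx' : R x^-1 by apply: pos; rewrite ?invr_eq0 // phiV //; plia.
  have := Hphi x x0; have uX : unitR (x ^+ D) by apply: unitRX.
  move=> /unitRV; rewrite invf_div => /(unitRM uX).
  rewrite mulrC divfK ?expf_neq0 // => /unit_rho; plia.
have phi_rho : phi rho = D.
  apply: (vrel_uniq (rho ^+ D)); rewrite ?expf_neq0 //; first exact: Hphi.
  by rewrite /vrel exprnP mulfV ?expfz_neq0.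
(* The image of [phi] may be a proper subgroup of the integers; dividing by its least positive
   element [g + 1] normalizes the valuation. *)
have ex : exists n, boolp.asbool (exists2 x, x != 0 & phi x = n.+1).
  by exists D.-1; apply/boolp.asboolP; exists rho; rewrite // prednK.
case: (ex_minnP ex) => g /boolp.asboolP [x1 x10 phix1] ming.
pose v x : int := if x == 0 then 0 else (phi x %/ g.+1)%Z.
have vE x : x != 0 -> phi x = v x * g.+1.
  move=> x0; rewrite /v (negbTE x0).
  have := divz_eq (phi x) g.+1; set q := (phi x %/ _)%Z; set r := (phi x %% _)%Z => E.
  have r0 : 0 <= r by apply: modz_ge0.
  have ltr : r < g.+1 by apply: ltz_pmod.
  have [r00|rn0] := eqVneq r 0; first by rewrite E r00 addr0.
  have [n rE] : exists n : nat, r = n.+1 by exists (`|r|.-1)%N; plia.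
  have := ming n; rewrite leqNgt; have -> : (n < g)%N by plia.
  suff -> : boolp.asbool (exists2 x, x != 0 & phi x = n.+1) by move=> /(_ isT).
  apply/boolp.asboolP; exists (x / x1 ^ q).
    by rewrite mulf_neq0 // invr_eq0 expfz_neq0.
  rewrite phiM ?invr_eq0 ?expfz_neq0 // phiV ?expfz_neq0 // phiXz // phix1 -rE E.
  by rewrite addrC addKr.
have v_ge0 x : x != 0 -> (0 <= v x) <-> R x.
  by move=> x0; rewrite -phi_ge0 // vE // pmulr_lge0.
exists v; split.
- split.
  + by rewrite /v eqxx.
  + move=> x y x0 y0; have := phiM x y x0 y0; rewrite !vE ?mulf_neq0 //; pnia.
  + have vMn x y : x != 0 -> y != 0 -> v (x * y) = v x + v y.
      by move=> x0 y0; have := phiM x y x0 y0; rewrite !vE ?mulf_neq0 //; pnia.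
    have half x y : x != 0 -> y != 0 -> x + y != 0 -> R (x / y) -> v y <= v (x + y).
      move=> x0 y0 xy0 Rxy; have E : x + y = (x / y + 1) * y by rewrite mulrDl mul1r divfK.
      have z0 : x / y + 1 != 0 by apply: contraNneq xy0 => z0; rewrite E z0 mul0r.
      rewrite E vMn // lerDr; apply/v_ge0 => //.
      by apply: subringD => //; apply: subring1.
    move=> x y x0 y0 xy0; rewrite ge_min.
    have [Rxy|] := Rval (mulf_neq0 x0 (invr_neq0 y0)).
      by rewrite (half x y) // orbT.
    by rewrite invf_div addrC => Ryx; rewrite (half y x) // addrC.
  + move=> n; exists (x1 ^ n); rewrite expfz_neq0 //; split=> //.
    have := vE (x1 ^ n); rewrite expfz_neq0 // => /(_ isT); rewrite phiXz // phix1; pnia.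
- move=> x Rx; have [->|x0] := eqVneq x 0; first exact: vge0.
  by rewrite vgeE //; apply/v_ge0.
- have h0 : h != 0 by apply/eqP => h0; apply: Rh; rewrite h0; apply: subring0.
  by rewrite vgeE //; apply/negP => /v_ge0; auto.
Qed.
End PlaceOfRing.

Lemma exists_place_pole (k : finFieldType) (F : fieldType) (K : fieldExtType F)
    (iota : {rmorphism k -> K}) (tau h : K) :
  ratgen iota tau -> ~ integral_ev iota tau h ->
  exists v, [/\ is_place v, vge v tau 0 & ~~ vge v h 0].
Proof.
move=> gen /nonintegral_valuation_ring [R [subR Rev Rh Rval]].
have [v [pv Rv vh]] := ring_place gen subR Rev Rh Rval.
by exists v; split=> //; apply: Rv; rewrite -(evX iota tau).
Qed.

(** * Functions with bounded poles *)

Section RationalGenerator.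
Variables (k : finFieldType) (F : fieldType) (K : fieldExtType F).
Variable iota : {rmorphism k -> K}.
Implicit Types (tau x : K) (A B C : {poly k}) (v : K -> int).

Lemma place_subring v : is_place v -> is_subring (fun x => vge v x 0).
Proof.
move=> pv; split; [exact: vge1 | by move=> *; apply: vgeB |].
by move=> x y vx vy; rewrite -[0]addr0; apply: vgeM.
Qed.

(** Since [c ^+ #|k| = c], a nonzero multiple of the value is 0. *)
Lemma place_iota v c : is_place v -> c != 0 -> v (iota c) = 0.
Proof.
move=> pv c0; have := placeX pv (iota c) #|k|; rewrite -rmorphXn /= expf_card.
have := finNzRing_gt1 k; case: #|k| => // n; rewrite mulrS; case: n => // n _.
move/eqP; rewrite -subr_eq0 opprD addrA subrr sub0r oppr_eq0 mulrn_eq0 /=.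
by move/eqP.
Qed.

Lemma vge_iota v c : is_place v -> vge v (iota c) 0.
Proof.
move=> pv; have [->|c0] := eqVneq c 0; first by rewrite rmorph0 vge0.
by rewrite -(place_iota pv c0) vge_refl.
Qed.

Lemma vge_ev v tau A : is_place v -> vge v tau 0 -> vge v (ev iota tau A) 0.
Proof.
move=> pv; apply: (ev_subring (R := fun x => vge v x 0)); first exact: place_subring.
by move=> c; apply: vge_iota.
Qed.

Lemma ev_coef tau A n : (size A <= n)%N ->
  ev iota tau A = \sum_(i < n) iota A`_i * tau ^+ i.
Proof.
move=> le; rewrite /ev (horner_coef_wide _ (leq_trans (size_poly _ _) le)).
by apply: eq_bigr => i _; rewrite coef_map.
Qed.

Definition revp (n : nat) C : {poly k} := \poly_(i < n.+1) C`_(n - i).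

Lemma ev_revp tau n C : tau != 0 -> (size C <= n.+1)%N ->
  tau ^+ n * ev iota tau^-1 C = ev iota tau (revp n C).
Proof.
move=> t0 le; rewrite (ev_coef _ le) (ev_coef _ (size_poly _ _)) mulr_sumr.
rewrite (reindex_inj rev_ord_inj); apply: eq_bigr => i _ /=.
have lin : (i <= n)%N by rewrite -ltnS.
rewrite coef_poly ltn_ord subSS mulrCA; congr (_ * _).
rewrite exprVn -{1}(subnK lin) exprD mulrAC mulfV ?mul1r //.
by rewrite expf_neq0.
Qed.

Lemma ratgen_neq0 tau : ratgen iota tau -> tau != 0.
Proof.
case=> inj _; apply/eqP => t0; have := inj 'X; rewrite evX t0 => /(_ erefl) /eqP.
by rewrite polyX_eq0.
Qed.

Lemma ratgen_inv tau : ratgen iota tau -> ratgen iota tau^-1.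
Proof.
move=> gen; have t0 := ratgen_neq0 gen; have tV0 : tau^-1 != 0 by rewrite invr_eq0.
have inj C : ev iota tau^-1 C = 0 -> C = 0.
  move=> C0; have [n le] : exists n, (size C <= n.+1)%N by exists (size C).
  have := ev_revp t0 le; rewrite C0 mulr0 => /esym /(proj1 gen) r0.
  apply/polyP => i; rewrite coef0; have [lt|ge] := ltnP i n.+1.
    have := congr1 (fun P : {poly k} => P`_(n - i)) r0.
    by rewrite coef_poly coef0 ltnS leq_subr subKn.
  by rewrite nth_default // (leq_trans le).
split=> // x; split.
  case: (gen) => _ /[apply] -[A [B [B0 ->]]].
  have EA := ev_revp tV0 (leqnSn (size A)); have EB := ev_revp tV0 (leqnSn (size B)).
  rewrite invrK in EA EB.
  exists ('X^(size B) * revp (size A) A), ('X^(size A) * revp (size B) B); split.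
    apply: mulf_neq0; first by rewrite -size_poly_eq0 size_polyXn.
    apply: contraNneq B0 => B0; have := EB; rewrite B0 rmorph0 => /eqP.
    rewrite mulf_eq0 expf_eq0 invr_eq0 (negbTE t0) andbF /= => /eqP /(proj1 gen) ->.
    by rewrite eqxx.
  rewrite !rmorphM /= -EA -EB !rmorphXn /= !evX !exprVn.
  have [->|evB] := eqVneq (ev iota tau B) 0; first by rewrite !mulr0 invr0 !mulr0.
  by field; rewrite evB !expf_neq0.
case=> A [B [B0 ->]]; have evF C : ev iota tau^-1 C \in 1%VS.
  have := ev_revp t0 (leqnSn (size C)) => E.
  have -> : ev iota tau^-1 C = ev iota tau (revp (size C) C) / ev iota tau ('X^(size C)).
    by rewrite -E rmorphXn /= evX mulrAC mulfV ?mul1r ?expf_neq0.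
  by apply/(proj2 gen); exists (revp (size C) C), 'X^(size C); rewrite -size_poly_eq0 size_polyXn.
by rewrite (rpredM (evF A)) // rpredV.
Qed.

(** The rational root argument: in lowest terms the denominator divides a power of the numerator, so
    it is constant. *)
Lemma ratgen_integrally_closed tau x : ratgen iota tau -> x \in 1%VS -> integral_ev iota tau x ->
  exists A, x = ev iota tau A.
Proof.
move=> gen xF [G Gm /rootP].
have [A [B [cop B0 ->]]] : exists A B, [/\ coprimep A B, B != 0 & x = ev iota tau A / ev iota tau B].
  have [A [B [B0 ->]]] := proj1 (proj2 gen x) xF.
  have g0 : gcdp A B != 0 by rewrite gcdp_eq0 (negbTE B0) andbF.
  have EA := divpK (dvdp_gcdl A B); have EB := divpK (dvdp_gcdr A B).
  exists (A %/ gcdp A B), (B %/ gcdp A B); split.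
  - by apply: coprimep_div_gcd; rewrite B0 orbT.
  - by apply: contraNneq B0 => E0; rewrite -EB E0 mul0r.
  have EvA : ev iota tau A = ev iota tau (A %/ gcdp A B) * ev iota tau (gcdp A B).
    by rewrite -rmorphM EA.
  have EvB : ev iota tau B = ev iota tau (B %/ gcdp A B) * ev iota tau (gcdp A B).
    by rewrite -rmorphM EB.
  rewrite {1}EvA {1}EvB invfM mulrACA mulfV ?mulr1 //.
  by apply: contraNneq g0 => /(proj1 gen) ->.
have evB0 : ev iota tau B != 0 by apply: contraNneq B0 => /(proj1 gen) ->.
set n := (size G).-1; have sG : size G = n.+1.
  by rewrite prednK // lt0n size_poly_eq0 monic_neq0.
have Gn : G`_n = 1 by have := monicP Gm; rewrite /lead_coef -/n.
rewrite (horner_coef_wide _ (n := n.+1)); last by rewrite -sG size_poly.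
move/(congr1 (fun y => y * ev iota tau B ^+ n)); rewrite mul0r mulr_suml => E.
have : ev iota tau (\sum_(i < n.+1) G`_i * A ^+ i * B ^+ (n - i)) = 0.
  rewrite -E rmorph_sum; apply: eq_bigr => i _ /=.
  have lin : (i <= n)%N by rewrite -ltnS.
  rewrite coef_map !rmorphM !rmorphXn /= -!mulrA; congr (_ * _).
  have -> : ev iota tau B ^+ n = ev iota tau B ^+ (n - i) * ev iota tau B ^+ i.
    by rewrite -exprD subnK.
  by rewrite exprMn exprVn; field; rewrite expf_neq0.
move/(proj1 gen); rewrite big_ord_recr /= Gn subnn expr0 mulr1 mul1r => E0.
have : B %| A ^+ n.
  have -> : A ^+ n = - \sum_(i < n) G`_i * A ^+ i * B ^+ (n - i).
    by apply/eqP; rewrite -addr_eq0 addrC E0.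
  rewrite dvdpNr; apply: (big_ind (fun P => B %| P)) => [|P Q|i _]; rewrite ?dvdp0 //.
    exact: dvdp_add.
  apply: dvdp_mull.
  by have := ltn_ord i; rewrite -subn_gt0; case: (n - i)%N => // m _; rewrite exprS dvdp_mulIl.
have copn : coprimep (A ^+ n) B by apply: coprimep_expl.
move=> dvd; have : coprimep B B by move: copn; rewrite coprimep_sym; apply: coprimep_dvdl.
rewrite coprimepp => /eqP sB1.
have BC : B = (B`_0)%:P by apply: size1_polyC; rewrite sB1.
exists (A * (B`_0)^-1%:P); rewrite rmorphM /= evC fmorphV; congr (_ / _).
by rewrite BC evC coefC.
Qed.
End RationalGenerator.

Section BoundedPoles.
Variables (k : finFieldType) (F : fieldType) (K : fieldExtType F).
Variables (iota : {rmorphism k -> K}) (T : K).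
Hypothesis genT : ratgen iota T.
Implicit Types (x h : K) (v q : K -> int) (A : {poly k}).

Definition poleT v : int := if v T < 0 then - v T else 0.

(* [bpoles s] is the Riemann-Roch space of [s] times the polar divisor of [T]. *)
Definition bpoles (s : nat) x : Prop :=
  forall v, is_place v -> vge v x (- (s%:Z * poleT v)).

Let T0 : T != 0 := ratgen_neq0 genT.

Lemma poleT_ge0 v : 0 <= poleT v.
Proof. by rewrite /poleT; case: ltP => ?; plia. Qed.

Lemma bpoles_le s s' x : (s <= s')%N -> bpoles s x -> bpoles s' x.
Proof.
by move=> le Hx v pv; apply: vge_le (Hx v pv); have := poleT_ge0 v; pnia.
Qed.

Lemma bpolesB s x y : bpoles s x -> bpoles s y -> bpoles s (x - y).
Proof. by move=> Hx Hy v pv; apply: vgeB; [|apply: Hx|apply: Hy]. Qed.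

Lemma bpolesM s s' x y : bpoles s x -> bpoles s' y -> bpoles (s + s') (x * y).
Proof.
move=> Hx Hy v pv; apply: vge_le (vgeM pv (Hx v pv) (Hy v pv)).
by rewrite PoszD mulrDl opprD.
Qed.

Lemma bpoles1 : bpoles 0 1.
Proof. by move=> v pv; rewrite mul0r; apply: vge1. Qed.

Lemma bpolesT : bpoles 1 T.
Proof.
by move=> v pv; rewrite vgeE // mul1r /poleT; case: ltP => ?; plia.
Qed.

Lemma bpoles_iota c : bpoles 0 (iota c).
Proof. by move=> v pv; rewrite mul0r oppr0; apply: vge_iota. Qed.

Lemma bpoles_subring : is_subring (fun x => exists s, bpoles s x).
Proof.
split; first by exists 0%N; apply: bpoles1.
  move=> x y [s Hs] [s' Hs']; exists (s + s')%N; apply: bpolesB.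
    by apply: bpoles_le Hs; apply: leq_addr.
  by apply: bpoles_le Hs'; apply: leq_addl.
by move=> x y [s Hs] [s' Hs']; exists (s + s')%N; apply: bpolesM.
Qed.

Lemma bpoles_ev A : exists s, bpoles s (ev iota T A).
Proof.
apply: (ev_subring (R := fun x => exists s, bpoles s x)); first exact: bpoles_subring.
  by move=> c; exists 0%N; apply: bpoles_iota.
by exists 1%N; apply: bpolesT.
Qed.

Lemma bpoles_integral s x : bpoles s x -> integral_ev iota T x.
Proof.
move=> Hx; apply: boolp.contrapT => /(exists_place_pole genT) [v [pv vT /negP]]; apply.
apply: vge_le (Hx v pv); move: vT; rewrite vgeE // /poleT => vT.
by rewrite ltNge vT /= mulr0.
Qed.

(** Where [T^-1] is regular, [T ^+ s] absorbs every pole that [bpoles s] allows. *)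
Lemma bpoles_integral_inv s x : bpoles s x -> integral_ev iota T^-1 (x / T ^+ s).
Proof.
move=> Hx; apply: boolp.contrapT => /(exists_place_pole (ratgen_inv genT)) [v [pv vT /negP]].
apply; move: vT; rewrite vgeE ?invr_eq0 // placeV // => vT.
apply: (vge_le _ (vgeM pv (Hx v pv) (vge_refl v _))).
by rewrite placeV // placeX // /poleT; case: ltP => ?; plia.
Qed.

(** [x] is a polynomial in [T] and [x / T ^+ s] is one in [T^-1]; comparing the two expressions
    bounds the degree. *)
Lemma bpoles_ratgen s x : x \in 1%VS -> bpoles s x ->
  exists2 A : {poly k}, (size A <= s.+1)%N & x = ev iota T A.
Proof.
move=> xF Hx; have [A EA] := ratgen_integrally_closed genT xF (bpoles_integral Hx).
have TF : T \in 1%VS by rewrite -[T](evX iota); apply: ratgen_ev.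
have xF' : x / T ^+ s \in 1%VS by rewrite rpredM // rpredV rpredX.
have [C EC] := ratgen_integrally_closed (ratgen_inv genT) xF' (bpoles_integral_inv Hx).
exists A => //; set c := size C; have [->|A0] := eqVneq A 0; first by rewrite size_poly0.
have : 'X^c * A = 'X^s * revp c C.
  apply/eqP; rewrite -subr_eq0; apply/eqP/(proj1 genT); rewrite rmorphB !rmorphM /=.
  rewrite -(ev_revp iota T0 (leqnSn c)) -EC !rmorphXn /= !evX -EA.
  rewrite mulrCA [T ^+ s * _]mulrC divfK ?expf_neq0 //.
  by rewrite mulrC subrr.
move/(congr1 (fun P : {poly k} => size P)); rewrite mulrC size_mulXn // => E.
have := size_polyMleq 'X^s (revp c C); rewrite -E size_polyXn.
have := size_poly c.+1 (fun i => C`_(c - i)); rewrite -/(revp c C).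
by move: (size A) (size (revp c C)) => a b; plia.
Qed.

(** Over a finite field only finitely many polynomials have degree at most [s]. *)
Lemma bpoles_ratgen_bound q s : exists B : int, forall x, x \in 1%VS -> bpoles s x -> q x <= B.
Proof.
exists (\sum_(r : 'rV[k]_(s.+1)) `|q (ev iota T (rVpoly r))|) => x xF.
move=> /(bpoles_ratgen xF) [A sA ->]; rewrite -(poly_rV_K sA).
by rewrite (bigD1 (poly_rV A)) //= (le_trans (ler_norm _)) // lerDl sumr_ge0.
Qed.

(** Rescaling an integral equation of [h / T ^+ s] gives a monic multiple of the minimal polynomial
    of [h] that satisfies the weighted bound; Gauss's lemma passes the bound to the factor. *)
Lemma minPoly_vge tau s h v : ratgen iota tau -> is_place v -> vge v tau 0 ->
  integral_ev iota tau (h / T ^+ s) ->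
  forall i, vge v (minPoly 1%AS h)`_i
                (s%:Z * v T * ((size (minPoly 1%AS h)).-1%:Z - i%:Z)).
Proof.
move=> gen pv vtau [G Gm rG].
set P := map_poly (ev iota tau) G in rG; have Pm : P \is monic by apply: monic_map.
have PF i : P`_i \in 1%VS by rewrite coef_map; apply: ratgen_ev.
have Pv i : vge v P`_i 0 by rewrite coef_map; apply: vge_ev.
set n := (size P).-1; have sP : size P = n.+1 by rewrite prednK // lt0n size_poly_eq0 monic_neq0.
have Pn : P`_n = 1 by have := monicP Pm; rewrite /lead_coef -/n.
pose Q := \poly_(i < n.+1) (P`_i * T ^+ (s * (n - i))).
have Qn : Q`_n = 1 by rewrite coef_poly ltnSn subnn muln0 expr0 Pn mulr1.
have sQ : size Q = n.+1 by rewrite size_poly_eq // subnn muln0 expr0 Pn mulr1 oner_neq0.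
have Qm : Q \is monic by rewrite monicE /lead_coef sQ Qn.
have rQ : root Q h.
  rewrite /root horner_poly; have /eqP := rG; rewrite horner_coef sP.
  move/(congr1 (fun y => y * T ^+ (s * n))); rewrite mul0r mulr_suml => E0.
  rewrite -[X in _ == X]E0; apply/eqP; apply: eq_bigr => i _; have lin : (i <= n)%N by rewrite -ltnS.
  have -> : T ^+ (s * n) = T ^+ (s * (n - i)) * (T ^+ s) ^+ i.
    by rewrite -exprM -exprD -mulnDr subnK.
  by rewrite exprMn exprVn; field; rewrite !expf_neq0.
have QF : Q \is a polyOver 1%AS.
  apply/polyOverP => i; rewrite coef_poly; case: ifP => _; last exact: rpred0.
  rewrite rpredM // rpredX //.
  by rewrite -[T](evX iota); apply: ratgen_ev.
have /dvdpP[kap EQ] := minPoly_dvdp QF rQ; have mum := monic_minPoly 1%AS h.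
set mu := minPoly 1%AS h in mum EQ *.
have kapm : kap \is monic by rewrite -(monicMr kap mum) -EQ.
have := size_Mmonic (monic_neq0 kapm) mum; rewrite -EQ sQ => sn.
have eqn : n%:Z = (size mu).-1%:Z + (size kap).-1%:Z.
  have smu : (0 < size mu)%N by rewrite lt0n size_poly_eq0 monic_neq0.
  have skap : (0 < size kap)%N by rewrite lt0n size_poly_eq0 monic_neq0.
  by move: sn smu skap; move: (size mu) (size kap) => a b; plia.
apply: (monic_factor_vge pv mum kapm) => i; rewrite mulrC -EQ coef_poly -eqn.
case: ltnP => [lt|_]; last exact: vge0.
apply: vge_le (vgeM pv (Pv i) (vge_refl v _)); rewrite placeX // add0r.
rewrite -mulr_natr natz PoszM -subzn // le_eqVlt; apply/orP; left; apply/eqP; ring.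
Qed.

Lemma bpoles_minPoly s h v i : bpoles s h -> is_place v ->
  vge v (minPoly 1%AS h)`_i (- (s%:Z * poleT v * ((size (minPoly 1%AS h)).-1%:Z - i%:Z))).
Proof.
move=> Hh pv; rewrite /poleT; case: ltP => vT.
  rewrite mulrN mulNr opprK; apply: (minPoly_vge (ratgen_inv genT) pv).
    by rewrite vgeE ?invr_eq0 // placeV //; plia.
  exact: bpoles_integral_inv.
have vT0 : vge v T 0 by rewrite vgeE.
have iT : integral_ev iota T (h / T ^+ 0) by rewrite expr0 divr1; apply: bpoles_integral Hh.
by apply: vge_le (minPoly_vge genT pv vT0 iT i); rewrite mulr0 !mul0r oppr0.
Qed.

(** A norm argument. The constant coefficient [- (W.[h] * h)] of the minimal polynomial lies in the
    base field, where zeros of functions with bounded poles are bounded, and [W.[h]] has a bounded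
    pole at [q]; so [h] cannot vanish deeply at [q]. *)
Lemma bpoles_bound q s : is_place q ->
  exists B : int, forall h, h != 0 -> bpoles s h -> q h <= B.
Proof.
move=> pq; set d := (\dim {:K})%N.
have [B HB] := bpoles_ratgen_bound q (s * d).
exists (B + s%:Z * d%:Z * poleT q) => h h0 Hh.
have [r ler [r0 mon sz cF E]] := minPoly_relation h.
have Hmu := bpoles_minPoly _ Hh; set mu := minPoly 1%AS h in mon sz cF E Hmu.
rewrite sz /= in Hmu.
pose W := \poly_(i < r) mu`_i.+1.
have Er : mu`_r = 1 by have := monicP mon; rewrite /lead_coef sz.
have muE : mu = W * 'X + (mu`_0)%:P.
  apply/polyP => i; rewrite [RHS]coefD coefMX coefC [W`__]coef_poly; case: i => [|i] /=.
    by rewrite add0r.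
  rewrite addr0; case: ltnP => // le.
  by rewrite nth_default // sz ltnS.
have W0 : W.[h] != 0.
  have sW : size W = r by rewrite size_poly_eq // prednK // Er oner_neq0.
  have WF : W \is a polyOver 1%AS.
    by apply/polyOverP => i; rewrite coef_poly; case: ifP => _; rewrite ?rpred0 ?cF.
  apply/negP => /(minPoly_dvdp WF) /dvdp_leq; rewrite -/mu sz sW ltnn => /(_ _) /notF; apply.
  by rewrite -size_poly_eq0 sW -lt0n.
have muh : mu`_0 = - (W.[h] * h).
  have /eqP := root_minPoly 1%AS h; rewrite -/mu {1}muE !hornerE => /eqP.
  by rewrite addrC addr_eq0 => /eqP.
have qW : vge q W.[h] (- (s%:Z * d%:Z * poleT q)).
  rewrite horner_poly; apply: vge_sum => // i _.
  apply: vge_le (vgeM pq (Hmu q i.+1 pq) (vgeX pq i (Hh q pq))).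
  have := ltn_ord i; have := poleT_ge0 q; move: ler; rewrite -/d.
  move: (poleT q) (nat_of_ord i) => w j le w0 lt; rewrite -mulr_natr natz.
  have -> : - (s%:Z * w * (r%:Z - j.+1%:Z)) + - (s%:Z * w) * j%:Z = - (s%:Z * (r%:Z - 1) * w).
    by rewrite intS; ring.
  by rewrite lerN2; apply: ler_wpM2r => //; apply: ler_wpM2l => //; plia.
have : q mu`_0 <= B.
  apply: HB => // v pv; apply: vge_le (Hmu v 0%N pv).
  have := poleT_ge0 v; move: ler; rewrite -/d; move: (poleT v) => w le w0.
  rewrite lerN2 subr0 PoszM -[_ * d%:Z * w]mulrA [d%:Z * w]mulrC mulrA.
  by apply: ler_wpM2l; [apply: mulr_ge0|plia].
rewrite muh placeN // placeM //; move: qW; rewrite vgeE //.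
by move: (s%:Z * d%:Z * poleT q) => c; plia.
Qed.

(** If [Q] clears the denominators of the minimal polynomial of [x], then [Q * x] satisfies a monic
    equation with suitably bounded coefficients, and [monic_root_vge] bounds its poles. *)
Lemma bpoles_denom x : exists2 Q, Q != 0 & exists s, bpoles s Q /\ bpoles s (Q * x).
Proof.
have subV := bpoles_subring.
have denF y : y \in 1%VS -> exists2 Q, Q != 0 &
    exists s, [/\ bpoles s Q & bpoles s (Q * y)].
  case: (genT) => inj /[apply] -[A [B [B0 ->]]].
  have evB0 : ev iota T B != 0 by apply: contraNneq B0 => /inj ->.
  exists (ev iota T B) => //; have [a Ha] := bpoles_ev A; have [b Hb] := bpoles_ev B.
  exists (a + b)%N; rewrite mulrC divfK //; split.
    by apply: bpoles_le Hb; apply: leq_addl.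
  by apply: bpoles_le Ha; apply: leq_addr.
have [r ler [r0 mon sz cF E]] := minPoly_relation x.
set mu := minPoly 1%AS x in mon sz cF E.
have [Q Q0 [s [HQ Hmu]]] : exists2 Q, Q != 0 &
    exists s, bpoles s Q /\ forall i, (i < r)%N -> bpoles s (Q * mu`_i).
  elim: r {ler r0 sz E} => [|n [Q Q0 [s [HQ Hmu]]]].
    by exists 1; rewrite ?oner_neq0 //; exists 0%N; split=> //; apply: bpoles1.
  have [P P0 [s' [HP HPn]]] := denF _ (cF n).
  exists (Q * P); first exact: mulf_neq0.
  exists (s + s')%N; split=> [|i]; first exact: bpolesM.
  rewrite ltnS leq_eqVlt => /orP[/eqP->|lt].
    by rewrite -mulrA; apply: bpolesM.
  by rewrite mulrAC; apply: bpolesM => //; apply: Hmu.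
pose P := \poly_(i < r.+1) (mu`_i * Q ^+ (r - i)).
have Er : mu`_r = 1 by have := monicP mon; rewrite /lead_coef sz.
have Pr : P`_r = 1 by rewrite coef_poly ltnSn subnn expr0 mulr1.
have sP : size P = r.+1 by rewrite size_poly_eq // subnn expr0 mulr1 Er oner_neq0.
have Pm : P \is monic by rewrite monicE /lead_coef sP Pr.
have rP : root P (Q * x).
  rewrite /root horner_poly; have /eqP := root_minPoly 1%AS x; rewrite -/mu horner_coef sz.
  move/(congr1 (fun y => y * Q ^+ r)); rewrite mul0r mulr_suml => E0.
  rewrite -[X in _ == X]E0; apply/eqP; apply: eq_bigr => i _; have lin : (i <= r)%N by rewrite -ltnS.
  have -> : Q ^+ r = Q ^+ (r - i) * Q ^+ i by rewrite -exprD subnK.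
  by rewrite exprMn; ring.
exists Q => //; exists (s * r + s)%N; split; first by apply: bpoles_le HQ; apply: leq_addl.
move=> v pv; apply: (monic_root_vge pv Pm rP) => i; rewrite sP /= => lt.
rewrite coef_poly ltnS (ltnW lt).
have [m ->] : exists m, (r - i)%N = m.+1 by exists (r - i).-1; plia.
have -> : mu`_i * Q ^+ m.+1 = Q * mu`_i * Q ^+ m by rewrite exprS; ring.
apply: vge_le (vgeM pv (Hmu _ lt v pv) (vgeX pv m (HQ v pv))).
have := poleT_ge0 v; move: (poleT v) => w w0; rewrite -mulrS.
rewrite lerMn2r /= lerN2; apply: ler_wpM2r => //; plia.
Qed.
End BoundedPoles.

(** * Residue fields *)

Section ResidueField.
Variables (k : finFieldType) (F : fieldType) (K : fieldExtType F).
Variables (iota : {rmorphism k -> K}) (v : K -> int).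
Hypothesis pv : is_place v.

Lemma vge_unit (A : {poly k}) tau : vge v tau 0 -> ev iota tau A != 0 ->
  ~~ vge v (ev iota tau A) 1 -> v (ev iota tau A) = 0.
Proof.
by move=> vt A0; have := vge_ev iota A pv vt; rewrite !vgeE //; plia.
Qed.

(** [P] generates the prime of [k[tau]] below [v]; ramification allows a value above 1. If [v] were
    trivial on the base field, an element of value -1 would be a root of a monic polynomial with
    coefficients of value at least 0. *)
Lemma exists_min_uniformizer tau : ratgen iota tau -> vge v tau 0 ->
  exists P : {poly k}, [/\ P != 0, vge v (ev iota tau P) 1
    & forall A : {poly k}, A != 0 -> (size A < size P)%N -> ~~ vge v (ev iota tau A) 1].
Proof.
move=> gen vtau.
have [P [P0 vP]] : exists P : {poly k}, P != 0 /\ vge v (ev iota tau P) 1.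
  apply: boolp.contrapT => no.
  have vev A : v (ev iota tau A) = 0.
    have [->|A0] := eqVneq A 0; first by rewrite rmorph0 place0.
    apply: vge_unit => //; first by apply: contraNneq A0 => /(proj1 gen) ->.
    by apply/negP => vA; apply: no; exists A.
  case: (pv) => _ _ _ /(_ (-1)) [x [x0 vx]].
  have [r _ [_ mon sz cF _]] := minPoly_relation x.
  have := monic_root_vge0 pv mon (root_minPoly _ _); rewrite vgeE // vx.
  suff H i : vge v (minPoly 1%AS x)`_i 0 by move=> /(_ H).
  have [A [B [B0 E]]] := proj1 (proj2 gen _) (cF i).
  have [->|c0] := eqVneq ((minPoly 1%AS x)`_i) 0; first exact: vge0.
  rewrite vgeE // E; case: (eqVneq A 0) => [A0|A0]; first by move: c0; rewrite E A0 rmorph0 mul0r eqxx.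
  rewrite placeM // ?placeV ?invr_eq0 // ?vev //.
    by apply: contraNneq A0 => /(proj1 gen) ->.
  by apply: contraNneq B0 => /(proj1 gen) ->.
have ex : exists n, boolp.asbool (exists A : {poly k}, [/\ size A = n, A != 0 & vge v (ev iota tau A) 1]).
  by exists (size P); apply/boolp.asboolP; exists P.
case: (ex_minnP ex) => n /boolp.asboolP [Q [sQ Q0 vQ]] minn.
exists Q; split=> // A A0; rewrite sQ ltnNge; apply: contra => vA.
by apply: minn; apply/boolp.asboolP; exists A.
Qed.

(** The residues of the base field are represented by the remainders modulo [P]. *)
Lemma residue_ratfun tau : ratgen iota tau -> vge v tau 0 ->
  exists L : seq K, forall x, x \in 1%VS -> vge v x 0 -> exists2 y, y \in L & vge v (x - y) 1.
Proof.
move=> gen vtau; have [P [P0 vP minP]] := exists_min_uniformizer gen vtau.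
have evE (A : {poly k}) : A != 0 -> ev iota tau A != 0 by apply: contraNneq => /(proj1 gen) ->.
have modE (A : {poly k}) : vge v (ev iota tau A - ev iota tau (A %% P)) 1.
  rewrite -rmorphB {1}(divp_eq A P) addrK rmorphM /= -[1]add0r.
  by apply: vgeM => //; apply: vge_ev.
have mod0 (A : {poly k}) : vge v (ev iota tau A) 1 -> A %% P = 0.
  move=> vA; apply/eqP; apply: contraTT isT => r0.
  have := minP _ r0 (_ : _ < _)%N; rewrite ltn_modp P0 => /(_ isT) /negP [].
  by rewrite -[ev _ _ _](subKr (ev iota tau A)); apply: vgeB.
set n := (size P).-1; have sP : size P = n.+1 by rewrite prednK // lt0n size_poly_eq0.
have ltmod (A : {poly k}) : (size (A %% P)%R <= n)%N by rewrite -ltnS -sP ltn_modp.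
exists [seq ev iota tau (rVpoly r) | r : 'rV[k]_n] => x xF.
have [A [B [B0 ->]]] := proj1 (proj2 gen x) xF.
move: {2}(size B) (leqnn (size B)) => m; elim: m A B B0 => [|m IH] A B B0 leB vx.
  by move: leB; rewrite leqn0 size_poly_eq0 (negbTE B0).
(* If the denominator vanishes at [v], so does the numerator; [P] divides both, and cancelling it
   shortens [B]. *)
have [vB|vB] := boolP (vge v (ev iota tau B) 1).
  have EB := divp_eq B P; rewrite mod0 // addr0 in EB.
  have vA : vge v (ev iota tau A) 1.
    rewrite -[ev _ _ A](divfK (evE _ B0)) -[1]add0r; exact: vgeM.
  have EA := divp_eq A P; rewrite mod0 // addr0 in EA.
  have B10 : B %/ P != 0 by apply: contraNneq B0 => E0; rewrite EB E0 mul0r.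
  have Ex : ev iota tau A / ev iota tau B = ev iota tau (A %/ P) / ev iota tau (B %/ P).
    rewrite {1}EA {1}EB !rmorphM /= invfM mulrACA mulfV ?mulr1 //; exact: evE.
  rewrite Ex; apply: IH => //; last by rewrite -Ex.
  have sP1 : (1 < size P)%N.
    rewrite ltnNge; apply/negP => le1; have := minP 1 (oner_neq0 _).
    have /size1_polyC PC := le1; have c0 : P`_0 != 0 by apply: contraNneq P0 => c0; rewrite PC c0.
    by move: vP; rewrite PC evC vgeE ?fmorph_eq0 // place_iota.
  have le : (size P <= size B)%N by apply: dvdp_leq => //; rewrite EB dvdp_mulIr.
  by rewrite size_divp //; move: leB le sP1; move: (size B) (size P) => a b; lia.
have vB0 : v (ev iota tau B) = 0 by apply: vge_unit => //; apply: evE.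
(* Multiplication by [B] is injective on the finite set of remainders, hence onto; this divides by
   [B] modulo [P]. *)
pose f (r : 'rV[k]_n) : 'rV[k]_n := poly_rV ((B * rVpoly r) %% P).
have finj : injective f.
  move=> r r' /(congr1 rVpoly); rewrite !poly_rV_K // => E.
  have : vge v (ev iota tau (B * (rVpoly r - rVpoly r'))) 1.
    have := modE (B * (rVpoly r - rVpoly r')).
    by rewrite mulrBr modpD modpN E subrr rmorph0 subr0.
  rewrite rmorphM /= -[1]add0r -vB0 vgeMl // ?evE // => vr.
  apply: (can_inj rVpolyK); apply/eqP; rewrite -subr_eq0.
  apply: contraTT vr => /minP; apply; rewrite sP ltnS.
  apply: (leq_trans (size_polyD _ _)); rewrite size_polyN geq_max !size_poly.
  by [].
have [r Er] : exists r, f r = poly_rV (A %% P).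
  by have /(_ (poly_rV (A %% P))) := injF_onto finj; move=> /codomP[r ->]; exists r.
exists (ev iota tau (rVpoly r)); first by apply/imageP; exists r.
move/(congr1 rVpoly): Er; rewrite !poly_rV_K // => E.
rewrite -(vgeMl pv _ _ (evE _ B0)) vB0 add0r mulrBr mulrCA mulfV ?mulr1 ?evE //.
rewrite -rmorphM /= -[X in vge v X](subrKA (ev iota tau (A %% P))); apply: vgeD => //.
by rewrite -E -opprB vgeN.
Qed.

Definition residue_span (xs : seq K) (x : K) := exists2 a : nat -> K,
  forall i, a i \in 1%VS /\ vge v (a i) 0 & vge v (x - \sum_(i < size xs) a i * xs`_i) 1.

(** Linear independence of the residues of the list over the residue field of the base field. *)
Fixpoint residue_free (xs : seq K) : Prop :=
  if xs is x :: ys then [/\ vge v x 0, ~ residue_span ys x & residue_free ys] else True.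

Lemma residue_free_coef (xs : seq K) (a : nat -> K) : residue_free xs ->
  (forall i, a i \in 1%VS /\ vge v (a i) 0) ->
  vge v (\sum_(i < size xs) a i * xs`_i) 1 -> forall i, (i < size xs)%N -> vge v (a i) 1.
Proof.
elim: xs a => //= x xs IH a [vx nx Fxs] Ha; rewrite big_ord_recl /= => vs.
have v0 : vge v (a 0%N) 1.
  apply: boolp.contrapT => /negP va0.
  have a00 : a 0%N != 0 by apply: contraNneq va0 => ->; rewrite vge0.
  have va : v (a 0%N) = 0 by have := proj2 (Ha 0%N); move: va0; rewrite !vgeE //; plia.
  apply: nx; exists (fun i => - (a 0%N)^-1 * a i.+1).
    move=> i; have [aF vi] := Ha i.+1; split.
      by rewrite rpredM // rpredN rpredV; case: (Ha 0%N).
    by rewrite mulNr vgeN // -[0]add0r; apply: vgeM => //; rewrite vgeE ?invr_eq0 // placeV // va.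
  have -> : x - \sum_(i < size xs) - (a 0%N)^-1 * a i.+1 * xs`_i
     = (a 0%N)^-1 * (a 0%N * x + \sum_(i < size xs) a (bump 0 i) * xs`_i).
    rewrite mulrDr mulrA mulVf // mul1r; congr (_ + _); rewrite -sumrN mulr_sumr.
    by apply: eq_bigr => i _; rewrite !mulNr opprK mulrA.
  have -> : 1 = v (a 0%N)^-1 + 1 by rewrite placeV // va.
  by rewrite vgeMl ?invr_eq0.
have vrest : vge v (\sum_(i < size xs) a i.+1 * xs`_i) 1.
  rewrite -[X in vge v X 1](addKr (a 0%N * x)) addrC; apply: vgeB => //.
  by rewrite -[1]addr0; apply: vgeM.
case=> // i lt; exact: (IH (fun i => a i.+1)).
Qed.

(** A linear relation over the base field, divided by a coefficient of least value, reduces to a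
    nontrivial relation between residues. This is the inequality between residue degree and field
    degree. *)
Lemma residue_free_size (xs : seq K) : residue_free xs -> (size xs <= \dim {:K})%N.
Proof.
move=> Hxs; suff : free xs by rewrite /free => /eqP <-; apply: dimvS; apply: subvf.
elim: xs Hxs => [|x xs IH] Hx; first by rewrite nil_free.
rewrite free_cons IH ?andbT; last by case: Hx.
apply/negP => /(coord_span (X := in_tuple xs)) Ex.
pose c (i : nat) : K := if i is j.+1 then
  (if insub j is Some o then - (coord (in_tuple xs) o x)%:A else 0) else 1.
have cF i : c i \in 1%VS.
  case: i => [|i] /=; first exact: rpred1.
  by case: insub => [o|]; rewrite ?rpred0 // rpredN rpredZ ?rpred1.
have sum0 : \sum_(i < size (x :: xs)) c i * (x :: xs)`_i = 0.
  rewrite big_ord_recl /= mul1r {1}Ex -big_split /=; apply: big1 => i _.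
  by rewrite add0n valK mulNr mulr_algl subrr.
pose P := \poly_(i < size (x :: xs)) c i.
have P0 : P != 0.
  apply/eqP => /(congr1 (fun Q : {poly K} => Q`_0)); rewrite coef_poly coef0 /=.
  by move/eqP; rewrite oner_eq0.
have [m [i0 [Pi0 vi0 minP _]]] := weighted_min v 0 0 P0.
rewrite mul0r add0r in vi0.
have lt0 : (i0 < size (x :: xs))%N.
  by move: Pi0; rewrite coef_poly; case: ifP => //; rewrite eqxx.
suff : vge v (P`_i0 / P`_i0) 1 by rewrite mulfV // vgeE ?oner_neq0 // place1.
apply: (@residue_free_coef (x :: xs) (fun i => P`_i / P`_i0) Hx _ _ i0 lt0) => [i|].
  split.
    by rewrite rpredM ?rpredV // coef_poly; case: ifP => _; rewrite ?rpred0 ?cF.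
  rewrite -(vgeMl pv _ _ Pi0) mulrCA mulfV // mulr1 addr0 vi0.
  by have := minP i; rewrite mul0r add0r.
rewrite (eq_bigr (fun i : 'I_(size (x :: xs)) => (P`_i0)^-1 * (c i * (x :: xs)`_i))).
  by rewrite -mulr_sumr sum0 mulr0 vge0.
by move=> i _; rewrite coef_poly ltn_ord mulrAC mulrC.
Qed.

Lemma residue_span_finite (L0 xs : seq K) :
  (forall x, x \in 1%VS -> vge v x 0 -> exists2 y, y \in L0 & vge v (x - y) 1) ->
  (forall x, x \in xs -> vge v x 0) ->
  exists L : seq K, forall x, residue_span xs x -> exists2 y, y \in L & vge v (x - y) 1.
Proof.
move=> HL0; elim: xs => [|x xs IH] Hxs.
  exists [:: 0] => y [a _]; rewrite big_ord0 => vy; exists 0 => //.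
  by rewrite inE.
have [|L HL] := IH; first by move=> y yxs; apply: Hxs; rewrite inE yxs orbT.
exists [seq l * x + m | l <- L0, m <- L] => y [a Ha]; rewrite big_ord_recl /= => vy.
have [a0F va0] := Ha 0%N; have [l lL0 vl] := HL0 _ a0F va0.
have [|m mL vm] := HL (y - a 0%N * x).
  by exists (fun i => a i.+1) => // ; rewrite -addrA -opprD.
exists (l * x + m); first exact: allpairs_f.
have -> : y - (l * x + m) = (y - a 0%N * x - m) + (a 0%N - l) * x by ring.
apply: vgeD => //; rewrite -[1]addr0; apply: vgeM => //.
by apply: Hxs; rewrite inE eqxx.
Qed.

(** A finite list spans finitely many residues. Were the residue field infinite, [residue_free]
    lists could be extended forever, against the bound on their size. *)
Lemma residue_finite T : ratgen iota T ->
  exists L : seq K, forall x, vge v x 0 -> exists2 y, y \in L & vge v (x - y) 1.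
Proof.
move=> gen; have [tau gtau vtau] : exists2 tau, ratgen iota tau & vge v tau 0.
  have [vT|nvT] := boolP (vge v T 0); first by exists T.
  have T0 := ratgen_neq0 gen; exists T^-1; first exact: ratgen_inv.
  by rewrite vgeE ?invr_eq0 // placeV //; move: nvT; rewrite vgeE //; plia.
have [L0 HL0] := residue_ratfun gtau vtau.
apply: boolp.contrapT => no.
have greedy n : exists2 xs, size xs = n & residue_free xs.
  elim: n => [|n [xs sxs Fxs]]; first by exists [::].
  have [L HL] : exists L : seq K, forall x, residue_span xs x -> exists2 y, y \in L & vge v (x - y) 1.
    apply: (residue_span_finite HL0).
    elim: {n sxs} xs Fxs => // x xs IH [vx _ Fxs] y; rewrite inE => /orP[/eqP->//|]; exact: IH.
  apply: boolp.contrapT => nx; apply: no; exists L => x vx.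
  apply: boolp.contrapT => nL; apply: nx; exists (x :: xs); rewrite /= ?sxs //.
  by split=> // /HL.
have [xs sxs /residue_free_size] := greedy (\dim {:K}).+1.
by rewrite sxs ltnn.
Qed.

Lemma pigeonhole (L : seq K) (f : nat -> K) : (forall i, f i \in L) ->
  exists i j, (i < j)%N /\ f i = f j.
Proof.
move=> fL; pose s := [seq f i | i <- seq.iota 0 (size L).+1].
have : ~~ uniq s.
  apply/negP => us; have : (size s <= size L)%N.
    by apply: uniq_leq_size => // _ /mapP[i _ ->].
  by rewrite size_map size_iota ltnn.
move/(uniqPn 0) => [i [j [lt]]]; rewrite size_map size_iota => ltj.
have lti := ltn_trans lt ltj.
rewrite !(nth_map 0%N) ?size_iota // !nth_iota // !add0n => E.
by exists i, j.
Qed.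

Lemma exists_residue_order T t : ratgen iota T -> t != 0 -> v t = 0 ->
  exists2 n, (0 < n)%N & vge v (t ^+ n - 1) 1.
Proof.
move=> gen t0 vt; have [L HL] := residue_finite gen.
have vtX i : v (t ^+ i) = 0 by rewrite placeX // vt mul0rn.
have /boolp.choice[f Hf] : forall i : nat, exists y, y \in L /\ vge v (t ^+ i - y) 1.
  by move=> i; have [|y yL vy] := HL (t ^+ i); [rewrite vgeE ?expf_neq0 ?vtX|exists y].
have [|i [j [lt E]]] := @pigeonhole L f; first by move=> i; have [] := Hf i.
exists (j - i)%N; first by rewrite subn_gt0.
rewrite -(vgeMl pv _ _ (expf_neq0 i t0)) vtX add0r mulrBr mulr1 -exprD subnKC; last exact: ltnW.
have -> : t ^+ j - t ^+ i = (t ^+ j - f j) - (t ^+ i - f i) by rewrite E; ring.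
by apply: vgeB => //; case: (Hf j) (Hf i) => _ ? [].
Qed.

Variable p : nat.
Hypothesis charp : p \in [pchar k].

Let charpK : p \in [pchar K]. Proof. exact: (rmorph_pchar iota charp). Qed.

Lemma exp_pchar_sub1 (t : K) (n e : nat) : t ^+ (n * p ^ e) - 1 = (t ^+ n - 1) ^+ (p ^ e).
Proof.
have pe : [pchar K].-nat (p ^ e)%N.
  rewrite (eq_pnat _ (pcharf_eq charpK)) pnatX pnat_id ?orTb //.
  exact: pcharf_prime charpK.
by rewrite exprM -[t ^+ n in LHS](subrK 1) exprDn_pchar // expr1n addrK.
Qed.

Lemma place_natr n : ~~ (p %| n)%N -> (n%:R : K) != 0 /\ v n%:R = 0.
Proof.
move=> ndvd; have n0 : (n%:R : k) != 0 by rewrite -(dvdn_pcharf charp).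
by rewrite -(rmorph_nat iota) fmorph_eq0 n0 place_iota.
Qed.

(** With [x = t ^+ n] congruent to 1, the quotient of [x ^+ m - 1] by [x - 1] is congruent to [m], a
    unit because [p] does not divide it. *)
Lemma place_exp_sub1 (t : K) (n m : nat) : ~~ (p %| m)%N -> t ^+ n - 1 != 0 -> t ^+ (n * m) - 1 != 0 ->
  vge v (t ^+ n - 1) 1 -> v (t ^+ (n * m) - 1) = v (t ^+ n - 1).
Proof.
move=> pm x0 xm0 vx; have [m0 vm] := place_natr pm.
set x := t ^+ n in x0 vx *; rewrite exprM -/x subrX1.
suff [s0 vs] : \sum_(i < m) x ^+ i != 0 /\ v (\sum_(i < m) x ^+ i) = v m%:R.
  by rewrite placeM // vs vm addr0.
apply: (vge_near pv) => //; rewrite vm add0r.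
have -> : \sum_(i < m) x ^+ i - m%:R = \sum_(i < m) (x ^+ i - 1).
  by rewrite sumrB sumr_const card_ord.
apply: vge_sum => // i _; rewrite subrX1 -[X in vge v _ X]addr0; apply: vgeM => //.
have vx0 : vge v x 0.
  by rewrite -[x](subrK 1); apply: vgeD; rewrite ?vge1 //; apply: vge_le vx.
by apply: vge_sum => // j _; have := vgeX pv j vx0; rewrite mul0rn.
Qed.

(** If [t ^+ m] and [t ^+ m1] are both congruent to 1, with [m] and [m1] prime to [p], the value at
    [m1 * m] can be computed from either factor, so the two values agree. Frobenius then contributes
    the factor [p ^ e]. *)
Lemma place_exp_sub1_bound (t : K) : t != 0 -> v t = 0 -> (forall n, (0 < n)%N -> t ^+ n != 1) ->
  exists C : nat, forall m e, ~~ (p %| m)%N -> v (t ^+ (m * p ^ e) - 1) <= (C * p ^ e)%N%:Z.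
Proof.
move=> t0 vt tn.
have nz m : ~~ (p %| m)%N -> t ^+ m - 1 != 0.
  by move=> pm; rewrite subr_eq0 tn // lt0n; apply: contraNneq pm => ->; rewrite dvdn0.
suff [C HC] : exists C : nat, forall m, ~~ (p %| m)%N -> v (t ^+ m - 1) <= C%:Z.
  exists C => m e pm; rewrite exp_pchar_sub1 placeX // PoszM -mulr_natr natz.
  by apply: ler_wpM2r => //; apply: HC.
have [[m1 [pm1 v1]]|no] := boolp.EM (exists m1, ~~ (p %| m1)%N /\ vge v (t ^+ m1 - 1) 1).
  exists `|v (t ^+ m1 - 1)|%N => m pm.
  have [vm|] := boolP (vge v (t ^+ m - 1) 1); last first.
    by rewrite vgeE ?nz //; plia.
  have pmm : ~~ (p %| m1 * m)%N.
    by rewrite Euclid_dvdM ?negb_or ?pm1 // (pcharf_prime charp).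
  have E1 := place_exp_sub1 pm (nz _ pm1) (nz _ pmm) v1.
  rewrite mulnC in pmm E1.
  have E2 := place_exp_sub1 pm1 (nz _ pm) (nz _ pmm) vm.
  by rewrite -E2 E1; plia.
exists 0%N => m pm; have : ~~ vge v (t ^+ m - 1) 1 by apply/negP => vm; apply: no; exists m.
by rewrite vgeE ?nz //; plia.
Qed.
End ResidueField.

(** * Exponential sums *)

Lemma gap_le (a : int) (b G m : nat) : a < 0 -> (b + G <= m)%N -> a *+ m + G%:Z <= a *+ b.
Proof.
move=> a0 le; have [d ->] : exists d, m = (b + (G + d))%N by exists (m - (b + G))%N; lia.
have : a *+ (G + d) <= - (G + d)%N%:Z by rewrite -mulr_natr natz; nia.
by rewrite [_ *+ (b + _)]mulrnDr; move: (a *+ b) (a *+ (G + d)) => x y; lia.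
Qed.

Section GlobalField.
Variables (k : finFieldType) (F : fieldType) (K : fieldExtType F).
Variables (iota : {rmorphism k -> K}) (T : K).
Hypothesis genT : ratgen iota T.
Implicit Types (v q : K -> int).
Local Notation bpoles := (bpoles T).
Local Notation poleT := (poleT T).

(** A nonzero function without poles cannot vanish at [q], as its powers would vanish to unbounded
    order. Hence such functions inject into the finite residue field at [q]. *)
Lemma bpoles0_finite q : is_place q -> exists L : seq K, forall x, bpoles 0 x -> x \in L.
Proof.
move=> pq; have [B HB] := bpoles_bound genT 0%N pq.
have nopos x : bpoles 0 x -> vge q x 1 -> x = 0.
  move=> Hx qx; apply/eqP; apply: contraTT isT => x0.
  have Hn n : bpoles 0 (x ^+ n).
    by elim: n => [|n IH]; rewrite ?expr0 ?exprS; [exact: bpoles1|exact: (bpolesM Hx IH)].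
  have := HB (x ^+ `|B|.+1) (expf_neq0 _ x0) (Hn _).
  by rewrite placeX // -mulr_natr natz; move: qx; rewrite vgeE //; move: (q x) => a; nia.
have [L HL] := residue_finite pq genT.
have /boolp.choice[g Hg] : forall y, exists x,
    (exists x, bpoles 0 x /\ vge q (x - y) 1) -> bpoles 0 x /\ vge q (x - y) 1.
  move=> y; have [[x Hx]|nx] := boolp.EM (exists x, bpoles 0 x /\ vge q (x - y) 1).
    by exists x.
  by exists 0.
exists [seq g y | y <- L] => x Hx.
have qx : vge q x 0 by have := Hx q pq; rewrite mul0r oppr0.
have [y yL xy] := HL _ qx; apply/mapP; exists y => //.
have [Hgy gy] : bpoles 0 (g y) /\ vge q (g y - y) 1 by apply: Hg; exists x.
apply/eqP; rewrite -subr_eq0; apply/eqP/nopos; first exact: bpolesB.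
have -> : x - g y = (x - y) - (g y - y) by ring.
exact: vgeB.
Qed.

(** Euclid's argument: [A] vanishes at all places of [S] where [T] is regular, so a zero of
    [A * 'X + 1] at which [T] is regular lies outside [S]. *)
Lemma exists_place_notin S : exists v : K -> int, in_Sigma S v.
Proof.
have [A [A0 HA]] : exists A, A != 0 /\ forall v, List.In v S -> is_place v -> vge v T 0 ->
    vge v (ev iota T A) 1.
  elim: S => [|v S [A [A0 HA]]]; first by exists 1; rewrite oner_neq0.
  have [[pv vT]|no] := boolp.EM (is_place v /\ vge v T 0); last first.
    by exists A; split=> // w [<-|]; [move=> pv vT; case: no|exact: HA].
  have [P [P0 vP _]] := exists_min_uniformizer pv genT vT.
  exists (P * A); split=> [|w]; first exact: mulf_neq0.
  rewrite rmorphM /=; case=> [<- _ _|wS pw wT].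
    by rewrite -[1]addr0; apply: vgeM => //; apply: vge_ev.
  by rewrite -[1]add0r; apply: vgeM; rewrite ?vge_ev ?HA.
pose B := A * 'X + 1%:P.
have sB : (1 < size B)%N.
  by rewrite size_MXaddC (negbTE A0) /= ltnS lt0n size_poly_eq0.
have B0 : ev iota T B != 0.
  by apply/eqP => /(proj1 genT) B0; rewrite B0 size_poly0 in sB.
have nint : ~ integral_ev iota T (ev iota T B)^-1.
  have BF : (ev iota T B)^-1 \in 1%VS by rewrite rpredV; apply: ratgen_ev.
  move/(ratgen_integrally_closed genT BF) => [C EC].
  have : C * B - 1 = 0.
    by apply: (proj1 genT); rewrite rmorphB rmorphM rmorph1 /= -EC mulVf ?subrr.
  move/eqP; rewrite subr_eq0 => /eqP CB.
  have : B %| 1 by rewrite -CB dvdp_mulIr.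
  by rewrite dvdp1 => /eqP E; rewrite E in sB.
have [v [pv vT vB]] := exists_place_pole genT nint.
exists v; split=> // vS; have vA := HA v vS pv vT.
have vB1 : vge v (ev iota T B) 1 by move: vB; rewrite !vgeE ?invr_eq0 // placeV //; plia.
have : vge v 1 1.
  have -> : 1 = ev iota T B - ev iota T A * T.
    by rewrite /B rmorphD rmorphM /= evX evC rmorph1 addrAC subrr add0r.
  by apply: vgeB => //; rewrite -[1]addr0; apply: vgeM.
by rewrite vgeE ?oner_neq0 // place1.
Qed.

(** The additional zero at each place of [S] lets [Q ^+ n] cancel poles of order [n] there, at the
    price of [n * s] more poles along those of [T]. *)
Lemma exists_vanishing (S : seq (K -> int)) : exists2 Q, Q != 0 & exists s, bpoles s Q /\
  forall v, List.In v S -> is_place v -> vge v Q (1 - s%:Z * poleT v).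
Proof.
elim: S => [|v S [Q Q0 [s [HQ HS]]]].
  by exists 1; rewrite ?oner_neq0 //; exists 0%N; split=> //; apply: bpoles1.
have [pv|npv] := boolp.EM (is_place v); last first.
  by exists Q => //; exists s; split=> // w [<-|]; [|exact: HS].
case: (pv) => _ _ _ /(_ 1) [u [u0 vu]].
have [D D0 [s' [HD HDu]]] := bpoles_denom genT u.
exists (Q * (D * u)); first by rewrite !mulf_neq0.
exists (s + s')%N; split=> [|w wS pw]; first exact: bpolesM.
have -> : 1 - (s + s')%N%:Z * poleT w = 1 - s%:Z * poleT w + - (s'%:Z * poleT w).
  by rewrite PoszD; ring.
case: wS pw => [<-|wS] pw; last by apply: vgeM => //; [exact: HS|exact: HDu].
have -> : 1 - s%:Z * poleT v + - (s'%:Z * poleT v)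
  = - (s%:Z * poleT v) + (1 - s'%:Z * poleT v) by ring.
apply: vgeM => //; first exact: HQ.
by rewrite mulrC; apply: vge_le (vgeM pv (vge_refl v u) (HD v pv)); rewrite vu.
Qed.

Section ExponentialSum.
Variables (S : seq (K -> int)) (t : K) (q : K -> int) (p : nat).
Hypothesis charp : p \in [pchar k].
Hypothesis t0 : t != 0.
Hypothesis pq : is_place q.
Hypothesis qt : q t < 0.

Lemma nontorsion n : (0 < n)%N -> t ^+ n != 1.
Proof.
move=> n0; apply/eqP => tn; have := placeX pq t n; rewrite tn place1 // -mulr_natr natz.
by move: qt n0; move: (q t) => a; nia.
Qed.

Lemma exp_sub1_bound : exists C : nat, forall v, List.In v S -> is_place v -> v t = 0 ->
  forall m e, ~~ (p %| m)%N -> v (t ^+ (m * p ^ e) - 1) <= (C * p ^ e)%N%:Z.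
Proof.
elim: (S) => [|v s [C HC]]; first by exists 0%N.
have [[pv vt]|no] := boolp.EM (is_place v /\ v t = 0); last first.
  by exists C => w [<-|]; [move=> pv vt; case: no|exact: HC].
have [D HD] := place_exp_sub1_bound iota pv charp t0 vt nontorsion.
exists (C + D)%N => w [<-|ws] pw wt m e pm.
  by apply: le_trans (HD m e pm) _; rewrite lez_nat leq_mul2r leq_addl orbT.
by apply: le_trans (HC w ws pw wt m e pm) _; rewrite lez_nat leq_mul2r leq_addr orbT.
Qed.

(* The poles of [f / (t^m - 1)] are bounded independently of [m'], while a gap [G] in the
   exponents forces a zero of order about [G] at the pole [q] of [t]. *)
Lemma gap_vanish (s e : nat) : exists G : nat, forall m', ~~ (p %| m')%N ->
  forall (J : finType) (c : J -> K) (b : J -> nat),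
    (forall j, bpoles s (c j)) -> (forall j, (b j + G <= m' * p ^ e)%N) ->
    (forall v, in_Sigma S v ->
       vge v (\sum_j c j * t ^+ b j) (v (t ^+ (m' * p ^ e) - 1) - s%:Z * poleT v)) ->
    \sum_j c j * t ^+ b j = 0.
Proof.
have [Q Q0 [s1 [HQ HQS]]] := exists_vanishing S.
have [C HC] := exp_sub1_bound.
(* [n] bounds the zeros of [t ^+ m - 1] at the places of [S] where [t] is a unit, uniformly in [m'].
   [B] bounds the zero at [q] of [Q ^+ n] times the quotient; the gap chosen next exceeds [B] after
   allowing for [Q ^+ n] and the poles of the [c j]. *)
set n := (C * p ^ e)%N; have [B HB] := bpoles_bound genT (s + n * s1)%N pq.
exists (absz B + absz (s%:Z * poleT q)%R + absz (q Q *+ n)%R + 1)%N => m' pm J c b Hc Hb Hf.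
set f := \sum_j _ in Hf *; set m := (m' * p ^ e)%N in Hb Hf *.
apply/eqP; apply: contraTT isT => f0.
have m0 : (0 < m)%N.
  rewrite muln_gt0 expn_gt0 (prime_gt0 (pcharf_prime charp)) /= andbT lt0n.
  by apply: contraNneq pm => ->; rewrite dvdn0.
have tm0 : t ^+ m - 1 != 0 by rewrite subr_eq0 nontorsion.
pose h := f / (t ^+ m - 1).
have h0 : h != 0 by rewrite mulf_neq0 ?invr_eq0.
have vf v (l : int) : is_place v -> (forall j, l <= v t *+ b j) -> vge v f (l - s%:Z * poleT v).
  move=> pv Hl; apply: vge_sum => // j _; rewrite addrC.
  apply: vge_le (vgeM pv (Hc j v pv) (vge_refl v _)); rewrite placeX //.
  by rewrite lerD2l.
have vh v a : is_place v -> vge v f (v (t ^+ m - 1) + a) -> vge v h a.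
  move=> pv Hv; rewrite -(vgeMl pv _ _ tm0) mulrC divfK //.
have vneg v : is_place v -> v t < 0 -> v (t ^+ m - 1) = v t *+ m.
  move=> pv vt; have [] := @vge_near _ _ _ pv (t ^+ m - 1) (t ^+ m) _ (expf_neq0 _ t0).
    rewrite addrAC subrr sub0r vgeN // vgeE ?oner_neq0 // place1 // placeX //.
    by rewrite -mulr_natr natz; move: vt m0; move: (v t) => a; nia.
  by move=> _ ->; rewrite placeX.
(* At a pole of [t] the exponents stay below [m], so the denominator dominates; at a zero of [t] the
   denominator is a unit; elsewhere [n] bounds its order. *)
have hS v : is_place v -> List.In v S -> vge v h (- n%:Z - s%:Z * poleT v).
  move=> pv vS; have w0 := poleT_ge0 T v.
  have [vt|vt|vt] := ltgtP (v t) 0.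
  - apply: vh => //; rewrite vneg //; apply: (@vge_le _ _ _ (v t *+ m - s%:Z * poleT v)).
      by rewrite addrA lerD2r gerDl oppr_le0.
    apply: vf => // j; apply: ler_wnMn2l; first exact: ltW.
    by have := Hb j; lia.
  - apply: vh => //; have [||_ ->] := @vge_near _ _ _ pv (t ^+ m - 1) (-1).
    + rewrite opprK subrK placeN // place1 // add0r vgeE ?expf_neq0 // placeX //.
      by rewrite -mulr_natr natz; move: vt m0; move: (v t) => a; nia.
    + by rewrite oppr_eq0 oner_neq0.
    rewrite placeN // place1 // add0r; apply: (@vge_le _ _ _ (0 - s%:Z * poleT v)).
      by rewrite lerD2r oppr_le0.
    by apply: vf => // j; rewrite mulrn_wge0 // ltW.
  - apply: vh => //; apply: (@vge_le _ _ _ (0 - s%:Z * poleT v)).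
      by rewrite addrA lerD2r subr_le0; apply: HC.
    by apply: vf => // j; rewrite vt mul0rn.
pose H := Q ^+ n * h; have H0 : H != 0 by rewrite mulf_neq0 // expf_neq0.
have HH : bpoles (s + n * s1) H.
  move=> v pv; have [vS|vS] := boolp.EM (List.In v S).
    have := vgeM pv (vgeX pv n (HQS v vS pv)) (hS v pv vS); apply: vge_le.
    rewrite le_eqVlt; apply/orP; left; apply/eqP.
    by rewrite -mulr_natr natz PoszD PoszM; ring.
  have hv : vge v h (- (s%:Z * poleT v)) by apply: vh => //; apply: Hf.
  have := vgeM pv (vgeX pv n (HQ v pv)) hv; apply: vge_le.
  rewrite le_eqVlt; apply/orP; left; apply/eqP.
  by rewrite -mulr_natr natz PoszD PoszM; ring.
have := HB H H0 HH; rewrite placeM ?expf_neq0 // placeX //.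
suff : vge q h ((absz B + absz (s%:Z * poleT q)%R + absz (q Q *+ n)%R + 1)%N%:Z - s%:Z * poleT q).
  rewrite vgeE //; move: (q Q *+ n) (s%:Z * poleT q) => a w; plia.
apply: vh => //; rewrite vneg // addrA; apply: vf => // j.
exact: gap_le.
Qed.
End ExponentialSum.
End GlobalField.

(** * Integral linear systems and finite choices *)

Definition lifts_solutions (r n : nat) (A : 'M[int]_(r, n)) (N D m : nat) : Prop :=
  forall (a : 'cV[int]_n) (d : 'cV[int]_r),
    (forall i, `|d i ord0| <= D%:Z) -> (forall i, (m%:Z %| (A *m a - d) i ord0)%Z) ->
    exists2 x : 'cV[int]_n, A *m x = d & forall j, (N%:Z %| (x - a) j ord0)%Z.

(** In Smith form the equations read [s_i x_i = e_i]. If [s_i] is nonzero and [N s_i] divides [m],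
    the congruence makes [e_i / s_i] integral and congruent to the old coordinate modulo [N]. If
    [s_i = 0], then [m] divides [e_i], which is too small to be nonzero. That [m0] precedes [D]
    matters: it fixes the [p]-part of [m] before the range of the right-hand side is known. *)
Lemma integer_system (r n : nat) (A : 'M[int]_(r, n)) (N : nat) : (0 < N)%N ->
  exists m0, (0 < m0)%N /\ forall D : nat, exists B : nat, forall m : nat,
    (m0 %| m)%N -> (B <= m)%N -> lifts_solutions A N D m.
Proof.
move=> N0; have [L uL [R uR [s _ EA]]] := int_Smith_normal_form A.
set De := \matrix_(i, j) _ in EA.
have DeE (x : 'cV[int]_n) (i : 'I_r) (j : 'I_n) : i = j :> nat ->
    (De *m x) i ord0 = s`_i * x j ord0.
  move=> ij; rewrite mxE (bigD1 j) //= big1 => [|l nl]; first by rewrite mxE ij eqxx addr0.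
  rewrite mxE (_ : (i == l :> nat) = false) ?mulr0n ?mul0r //.
  by apply/negbTE; apply: contra nl => /eqP E; apply/eqP/val_inj; rewrite /= -E ij.
have De0 (x : 'cV[int]_n) (i : 'I_r) : (n <= i)%N -> (De *m x) i ord0 = 0.
  move=> le; rewrite mxE big1 // => l _; rewrite mxE (_ : (i == l :> nat) = false) ?mul0r //.
  by apply/negbTE/eqP => E; have := ltn_ord l; rewrite -E ltnNge le.
pose w (i : nat) := if s`_i == 0 then 1%N else absz s`_i.
exists (N * \prod_(i < r) w i)%N; split.
  by rewrite muln_gt0 N0 prodn_gt0 // => i; rewrite /w; case: ifP => // /negbT; lia.
move=> D; pose C : int := \sum_i \sum_j `|invmx L i j|.
exists (absz (D%:Z * C)).+1 => m dvm ltm a d Hd Had.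
pose e := invmx L *m d; pose a' := R *m a.
have C0 i : 0 <= \sum_j `|invmx L i j| by apply: sumr_ge0.
have He i : `|e i ord0| <= D%:Z * C.
  have le : \sum_j `|invmx L i j| <= C by rewrite /C [leRHS](bigD1 i) //= lerDl sumr_ge0.
  apply: (@le_trans _ _ (D%:Z * \sum_j `|invmx L i j|)); last exact: ler_wpM2l.
  rewrite mxE (le_trans (ler_norm_sum _ _ _)) // mulr_sumr ler_sum // => j _.
  by rewrite normrM mulrC; apply: ler_wpM2r.
have Hm i : (m%:Z %| (De *m a') i ord0 - e i ord0)%Z.
  have -> : (De *m a') i ord0 - e i ord0 = (invmx L *m (A *m a - d)) i ord0.
    by rewrite EA mulmxBr -!mulmxA mulKmx // !mxE.
  by rewrite mxE rpred_sum // => j _; apply: dvdz_mull.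
have small i : (m%:Z %| e i ord0)%Z -> e i ord0 = 0.
  move=> dv; apply/eqP; apply: contraTT isT => nz; have := He i.
  by have : (m <= absz (e i ord0))%N; [apply: dvdn_leq => //|]; lia.
have dvw (i : nat) : (i < r)%N -> s`_i != 0 -> exists c, m%:Z = N%:Z * s`_i * c.
  move=> lt nz; have : ((N * w i)%N %| m)%N.
    by apply: dvdn_trans dvm; rewrite (bigD1 (Ordinal lt)) //= mulnA dvdn_mulr.
  rewrite /w (negbTE nz) => /dvdnP[c ->].
  by exists (c%:Z * Num.sg s`_i); rewrite !PoszM abszE [`|_|]normrEsg; ring.
pose x' : 'cV[int]_n := \col_j (if insub (j : nat) is Some i then
   if s`_(j : nat) == 0 then a' j ord0 else (e i ord0 %/ s`_(j : nat))%Z else a' j ord0).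
have x'E (i : 'I_r) (j : 'I_n) : i = j :> nat -> s`_i != 0 ->
    s`_i * x' j ord0 = e i ord0 /\ (N%:Z %| x' j ord0 - a' j ord0)%Z.
  move=> ij nz; rewrite mxE -ij valK (negbTE nz).
  have [c Ec] := dvw i (ltn_ord i) nz.
  have := Hm i; rewrite (DeE _ _ j) // Ec => /dvdzP[q Eq].
  have Ee : e i ord0 = (a' j ord0 - q * N%:Z * c) * s`_i.
    by rewrite -[LHS](subKr (s`_i * a' j ord0)) Eq; ring.
  rewrite Ee mulzK //; split; first by rewrite mulrC.
  by apply/dvdzP; exists (- (q * c)); ring.
have Nx j : (N%:Z %| x' j ord0 - a' j ord0)%Z.
  have [lt|ge] := ltnP j r; last first.
    by rewrite mxE insubN ?subrr ?dvdz0 // -leqNgt.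
  have [s0|nz] := eqVneq s`_j 0; last by case: (x'E (Ordinal lt) j).
  by rewrite mxE insubT s0 eqxx subrr dvdz0.
have Ex : De *m x' = e.
  apply/matrixP => i z; rewrite (ord1 z) {z}.
  have [lt|ge] := ltnP i n; last first.
    by rewrite De0 // small //; have := Hm i; rewrite De0 // sub0r rpredN.
  rewrite (DeE _ _ (Ordinal lt)) //.
  have [s0|nz] := eqVneq s`_i 0; last by case: (x'E i (Ordinal lt)).
  rewrite s0 mul0r small //.
  by have := Hm i; rewrite (DeE _ _ (Ordinal lt)) // s0 mul0r sub0r rpredN.
exists (invmx R *m x').
  by rewrite EA -!mulmxA mulKVmx // Ex mulKVmx.
move=> j; have -> : invmx R *m x' - a = invmx R *m (x' - a').
  by rewrite mulmxBr mulKmx.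
rewrite mxE rpred_sum // => i _; apply: dvdz_mull.
by have := Nx i; rewrite !mxE.
Qed.

Lemma chain_stable (I : finType) (P : nat -> {set I}) :
  (forall i, P i \subset P i.+1) -> exists2 i, (i <= #|I|)%N & P i.+1 = P i.
Proof.
move=> mono; apply: boolp.contrapT => no.
have card n : (n <= #|I|.+1)%N -> (n <= #|P n|)%N.
  elim: n => // n IH lt; apply: leq_ltn_trans (IH (ltnW lt)) _.
  apply: proper_card; rewrite properEneq mono andbT.
  by apply/eqP => E; apply: no; exists n.
by have := card _ (leqnn _); rewrite leqNgt ltnS max_card.
Qed.

Lemma finite_choice_bound (I : finType) (f : I -> nat) : exists B, forall i, (f i <= B)%N.
Proof. by exists (\max_i f i)%N => i; apply: leq_bigmax. Qed.

(** For each index where the property fails somewhere on [S], one point of failure goes into the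
    list. *)
Lemma finite_witnesses (I : finType) (V : Type) (S : V -> Prop) (P : I -> V -> Prop) :
  exists Tl : seq V, (forall v, List.In v Tl -> S v) /\
    forall i, (forall v, List.In v Tl -> P i v) -> forall v, S v -> P i v.
Proof.
suff [Tl [HS HP]] : exists Tl : seq V, (forall v, List.In v Tl -> S v) /\
    forall i, i \in enum I -> (forall v, List.In v Tl -> P i v) -> forall v, S v -> P i v.
  by exists Tl; split=> // i; apply: HP; rewrite mem_enum.
elim: (enum I) => [|i s [Tl [HS HP]]]; first by exists [::].
have [[v [Sv nP]]|no] := boolp.EM (exists v, S v /\ ~ P i v); last first.
  exists Tl; split=> // j; rewrite inE => /orP[/eqP-> _ v Sv|/HP//].
  by apply: boolp.contrapT => nP; apply: no; exists v.
exists (v :: Tl); split=> [w [<-//|/HS//]|j].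
rewrite inE => /orP[/eqP->|js] Hj.
  by case: nP; apply: Hj; left.
by apply: HP => // w wT; apply: Hj; right.
Qed.

Lemma list_bound (V : Type) (Tl : seq V) (f : V -> int) :
  exists N : int, forall v, List.In v Tl -> f v <= N.
Proof.
elim: Tl => [|v Tl [N HN]]; first by exists 0.
exists (Num.max (f v) N) => w [<-|/HN le]; rewrite le_max ?lexx //.
by rewrite le orbT.
Qed.

Section CenteredResidue.
Variable m : nat.
Hypothesis m0 : (0 < m)%N.

(** The representative of [x] in the interval [(-m/2, m/2]]; its absolute value is the distance to 0
    on the circle of residues modulo [m]. *)
Definition cmod (x : int) : int :=
  let r := (x %% m%:Z)%Z in if r + r <= m%:Z then r else r - m%:Z.

Lemma cmodP x : [/\ (m%:Z %| x - cmod x)%Z, cmod x + cmod x <= m%:Z & - m%:Z < cmod x + cmod x].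
Proof.
have nz : m%:Z != 0 by lia.
have := modz_ge0 x nz; have := ltz_pmod x (_ : 0 < m%:Z); have E := divz_eq x m%:Z.
rewrite /cmod; move: E; set r := (x %% _)%Z; set c := (x %/ _)%Z => -> /(_ _) lt ge.
have {}lt : r < m%:Z by apply: lt; lia.
case: ifP => le; split; try lia; apply/dvdzP; first by exists c; ring.
by exists (c + 1); ring.
Qed.

Lemma cmod_uniq x d : (m%:Z %| x - d)%Z -> `|d| + `|d| < m%:Z -> cmod x = d.
Proof.
move=> dv lt; have [dv' le gt] := cmodP x.
have : (m%:Z %| cmod x - d)%Z.
  have -> : cmod x - d = (x - d) - (x - cmod x) by ring.
  exact: rpredB.
case/dvdzP => q Eq; have [q0|q1] := eqVneq q 0; first by move: Eq; rewrite q0; lia.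
by move: (cmod x) Eq le gt => y Eq le gt; nia.
Qed.
End CenteredResidue.

Definition lin (n : nat) (l a : 'I_n -> int) : int := \sum_i l i * a i.

Section PeriodicPowers.
Variables (F : fieldType) (K : fieldExtType F) (v : K -> int) (t : K).
Hypotheses (pv : is_place v) (t0 : t != 0) (vt : v t = 0).

Lemma placeXz0 (x : int) : v (t ^ x) = 0.
Proof. by rewrite placeXz // vt mulr0. Qed.

Lemma vge_expz (x : int) : vge v (t ^ x) 0.
Proof. by rewrite vgeE ?expfz_neq0 // placeXz0. Qed.

(** As [t] is a unit at [v], [t ^+ m - 1] divides [t ^+ (m * n) - 1] in the valuation ring. *)
Lemma periodic_expz (m : nat) (x y : int) : (m%:Z %| x - y)%Z ->
  vge v (t ^ x - t ^ y) (v (t ^+ m - 1)).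
Proof.
have nat_case (n : nat) : vge v (t ^+ (m * n) - 1) (v (t ^+ m - 1)).
  rewrite exprM subrX1 -[X in vge v _ X]addr0; apply: vgeM; rewrite ?vge_refl //.
  by apply: vge_sum => // i _; rewrite -exprM exprnP; apply: vge_expz.
case/dvdzP => q Eq.
have ttx z : t ^ (y + z) = t ^ y * t ^ z by rewrite expfzDr.
have -> : t ^ x - t ^ y = t ^ y * (t ^ (q * m%:Z) - 1).
  by rewrite mulrBr mulr1 -ttx -Eq [y + _]addrC subrK.
rewrite -[v _]add0r; apply: vgeM; rewrite ?vge_expz //.
case: q {Eq} => n; first by rewrite mulrC -PoszM -exprnP.
have -> : t ^ (Negz n * m%:Z) - 1 = - (t ^ (Negz n * m%:Z) * (t ^+ (m * n.+1) - 1)).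
  rewrite mulrBr mulr1 exprnP -expfzDr //.
  have -> : Negz n * m%:Z + (m * n.+1)%N = 0 by rewrite NegzE PoszM; ring.
  by rewrite expr0z opprB.
by rewrite vgeN // -[v _]add0r; apply: vgeM; rewrite ?vge_expz.
Qed.
End PeriodicPowers.

Section ExponentialSum.
Variables (k : finFieldType) (F : fieldType) (K : fieldExtType F).
Variables (iota : {rmorphism k -> K}) (T : K).
Hypothesis genT : ratgen iota T.
Variables (S : seq (K -> int)) (t : K) (q : K -> int) (p : nat).
Hypothesis charp : p \in [pchar k].
Hypothesis t0 : t != 0.
Hypothesis tS : forall v, in_Sigma S v -> v t = 0.
Hypothesis pq : is_place q.
Hypothesis qt : q t < 0.
Local Notation bpoles := (bpoles T).
Local Notation poleT := (poleT T).

Variable J : finType.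

Lemma gap_vanish_int (s e : nat) : exists G : nat, forall m', ~~ (p %| m')%N ->
  forall (c : J -> K) (x : J -> int) (l : int),
    (forall j, bpoles s (c j)) -> (forall j, l <= x j) ->
    (forall j, x j + G%:Z <= l + (m' * p ^ e)%N%:Z) ->
    (forall v, in_Sigma S v ->
       vge v (\sum_j c j * t ^ x j) (v (t ^+ (m' * p ^ e) - 1) - s%:Z * poleT v)) ->
    \sum_j c j * t ^ x j = 0.
Proof.
have [G HG] := gap_vanish genT S charp t0 pq qt s e.
exists G => m' pm c x l Hc Hl Hx Hv; pose b j := absz (x j - l).
have xb j : x j = l + (b j)%:Z by rewrite /b; have := Hl j; lia.
have E : \sum_j c j * t ^ x j = t ^ l * \sum_j c j * t ^+ b j.
  by rewrite mulr_sumr; apply: eq_bigr => j _; rewrite xb expfzDr // mulrCA.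
rewrite E (HG m' pm J c b Hc) ?mulr0 // => [j|v vS].
  by have := Hx j; rewrite xb; lia.
have := Hv v vS; rewrite E; case: vS => pv nS.
have vt : v (t ^ l) = 0 by apply: placeXz0 => //; apply: tS.
by rewrite -[X in vge v _ X]add0r -vt vgeMl // expfz_neq0.
Qed.

(* The clusters of exponents at scale [R1] contain no pair at a distance in [(R1, R2]], so each
   cluster can be rotated to the top, with a gap of length about [R2] below it. *)
Lemma cluster_vanish (c : J -> K) (s m R1 R2 G : nat) (x : J -> int) (j0 : J) :
  (forall j, bpoles s (c j)) ->
  (0 < m)%N -> (4 * R2 < m)%N -> (R1 + G <= R2)%N ->
  (forall y : J -> int, (forall j, (m%:Z %| y j - (x j - x j0))%Z) ->
     (forall j, - m%:Z + R2%:Z <= y j) -> (forall j, y j <= R1%:Z) ->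
     \sum_j c j * t ^ y j = 0) ->
  (forall j, `|cmod m (x j - x j0)| <= R2%:Z -> `|cmod m (x j - x j0)| <= R1%:Z) ->
  (let f := \sum_(j | `|cmod m (x j - x j0)| <= R1%:Z) c j * t ^ cmod m (x j - x j0) in
   f != 0 -> q f + s%:Z * poleT q < R2%:Z) ->
  \sum_(j | `|cmod m (x j - x j0)| <= R1%:Z) c j * t ^ cmod m (x j - x j0) = 0.
Proof.
clear charp; move=> Hc m0 ltm le12 vanish gap; set f := \sum_(j | _) _ => /= small.
set d := fun j => cmod m (x j - x j0).
(* The cluster keeps its centered exponents; every other exponent is represented by a negative
   integer, which leaves the gap just above [- m]. *)
pose y j := if `|d j| <= R1%:Z then d j else if d j < 0 then d j else d j - m%:Z.
have dP j := cmodP m0 (x j - x j0).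
have far j : ~~ (`|d j| <= R1%:Z) -> R2%:Z < `|d j|.
  by move=> nle; rewrite ltNge; apply: contra nle => /gap.
have sum0 : \sum_j c j * t ^ y j = 0.
  apply: vanish => j; have := dP j; rewrite -/(d j) /y => -[dv le gt].
  - case: ifP => _; first by rewrite -opprB rpredN.
    case: ifP => _; first by rewrite -opprB rpredN.
    have -> : d j - m%:Z - (x j - x j0) = - (x j - x j0 - d j) - m%:Z by ring.
    by rewrite rpredB ?rpredN // dvdzz.
  - by case: ifP => [|/negbT /far]; [lia|case: ifP; lia].
  - by case: ifP => [|/negbT /far]; [lia|case: ifP; lia].
apply/eqP; apply: contraTT isT => /[dup] f0 /small lt.
(* The full sum is zero, so [f] is minus its far part. There the exponents are at most [- R2], and
   [q t < 0] turns this into a zero at [q] deeper than [small] permits. *)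
have : vge q f (R2%:Z - s%:Z * poleT q).
  have -> : f = - \sum_(j | ~~ (`|d j| <= R1%:Z)) c j * t ^ y j.
    apply/eqP; rewrite -addr_eq0 -[X in _ == X]sum0 [X in _ == X](bigID (fun j => `|d j| <= R1%:Z)) /=.
    apply/eqP; congr (_ + _); apply: eq_bigr => j le; by rewrite /y le.
  rewrite vgeN //; apply: vge_sum => // j nle; rewrite addrC.
  apply: vge_le (vgeM pq (Hc j q pq) (vge_refl q _)); rewrite lerD2l placeXz //.
  have yj : y j <= - R2%:Z.
    rewrite /y (negbTE nle); have := far _ nle; have := dP j; rewrite -/(d j) => -[_ le gt].
    by case: ifP; lia.
  by move: (y j) yj qt => a; move: (q t) => b; nia.
by rewrite vgeE //; move: (s%:Z * poleT q) lt => w; plia.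
Qed.
End ExponentialSum.

(** * From approximate to exact zeros of exponential sums *)

Section Approximation.
Variables (k : finFieldType) (F : fieldType) (K : fieldExtType F).
Variables (iota : {rmorphism k -> K}) (T : K).
Hypothesis genT : ratgen iota T.
Variables (S : seq (K -> int)) (t : K) (q : K -> int) (p : nat).
Hypothesis charp : p \in [pchar k].
Hypothesis t0 : t != 0.
Hypothesis tS : forall v, in_Sigma S v -> v t = 0.
Hypothesis pq : is_place q.
Hypothesis qt : q t < 0.
Local Notation bpoles := (bpoles T).
Local Notation poleT := (poleT T).

Variables (I J : finType) (n : nat) (L : J -> 'I_n -> int).

(** Exponents in [[-R, R]] give finitely many sums, so their orders at [q] are bounded by a constant
    independent of the exponents to be approximated. The margin [R + R + G] makes closeness
    transitive and leaves room for the gap. *)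
Lemma exists_scale (c : I -> J -> K) (s R G : nat) : exists R' : nat, (R + R + G <= R')%N /\
  forall i (P : pred J) (d : J -> int), (forall j, P j -> `|d j| <= R%:Z) ->
    let f := \sum_(j | P j) c i j * t ^ d j in f != 0 -> q f + s%:Z * poleT q < R'%:Z.
Proof.
pose f (z : I * {set J} * {ffun J -> 'I_(R + R).+1}) : K :=
  \sum_(j in z.1.2) c z.1.1 j * t ^ ((z.2 j : nat)%:Z - R%:Z).
have [B HB] := finite_choice_bound (fun z => absz (q (f z) + s%:Z * poleT q)).
exists (R + R + G + B).+1; split; first by lia.
move=> i P d Hd fd _; 
  pose z := (i, [set j | P j],
    [ffun j => inord (absz (d j + R%:Z))] : {ffun J -> 'I_(R + R).+1}).
have -> : fd = f z.
  rewrite /f /fd /=; apply: eq_big => [j|j Pj]; first by rewrite inE.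
  congr (_ * _ ^ _); rewrite ffunE inordK; have := Hd j Pj; lia.
by have := HB z; move: (q _ + _) => w; lia.
Qed.

Lemma periodic_sum (c : J -> K) (s m : nat) (v : K -> int) (x y : J -> int) :
  in_Sigma S v -> (forall j, bpoles s (c j)) -> (forall j, (m%:Z %| x j - y j)%Z) ->
  vge v (\sum_j c j * t ^ x j) (v (t ^+ m - 1) - s%:Z * poleT v) ->
  vge v (\sum_j c j * t ^ y j) (v (t ^+ m - 1) - s%:Z * poleT v).
Proof.
move=> vS Hc Hxy Hx; have vt := tS vS; case: vS => pv _.
rewrite -[X in vge v X _](subKr (\sum_j c j * t ^ x j)); apply: vgeB => //.
rewrite -sumrB; apply: vge_sum => // j _; rewrite -mulrBr [X in vge v _ X]addrC.
by apply: vgeM => //; [exact: (Hc j v pv)|exact: periodic_expz].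
Qed.

Lemma exp_sum_approx_bpoles (c : I -> J -> K) (s N : nat) :
  (forall i j, bpoles s (c i j)) -> (0 < N)%N ->
  exists (Tl : seq (K -> int)) (N1 : int), (forall v, List.In v Tl -> in_Sigma S v) /\
    forall a : 'I_n -> int,
      (forall i v, List.In v Tl -> vge v (\sum_j c i j * t ^ lin (L j) a) N1) ->
      exists2 x : 'I_n -> int, forall l, (N%:Z %| x l - a l)%Z &
        forall i, \sum_j c i j * t ^ lin (L j) x = 0.
Proof.
move=> Hc N0; have pr : prime p := pcharf_prime charp.
(* There is one system for each possible closeness relation [E]; zero rows outside [E] give all
   systems the same shape. *)
pose row (E : {set J * J}) : 'M[int]_(#|{: J * J}|, n) := \matrix_(r, l)
  (if enum_val r \in E then L (enum_val r).1 l - L (enum_val r).2 l else 0).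
have /boolp.choice[M HM] := fun E => integer_system (row E) N0.
(* [M0] serves every [E], because the relation that will occur depends on [a], which comes later. *)
pose M0 := (\prod_E M E)%N; pose e := logn p M0; pose M1 := (M0`_p^')%N.
have M00 : (0 < M0)%N by rewrite prodn_gt0 // => E; case: (HM E).
have EM : M0 = (M1 * p ^ e)%N by rewrite -p_part mulnC partnC.
have pM1 : ~~ (p %| M1)%N by rewrite -p'natE // part_pnat.
have [G HG] := gap_vanish_int genT charp t0 tS pq qt J s e.
have /boolp.choice[Phi HPhi] := fun R => exists_scale c s R G.
pose Rk u := iter u Phi 0%N.
have Rmono u w : (Rk u <= Rk (u + w))%N.
  elim: w => [|w IH]; first by rewrite addn0.
  rewrite addnS (leq_trans IH) //; have [le _] := HPhi (Rk (u + w)%N).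
  rewrite (_ : Rk (u + w).+1 = Phi (Rk (u + w)%N)) //.
  by apply: leq_trans le; rewrite -addnA leq_addr.
set N2 := #|{: J * J}|; pose Rmax := Rk N2.+1.
have /boolp.choice[B HB] := fun E => proj2 (HM E) Rmax.
have [Bm HBm] := finite_choice_bound B.
(* The second factor is 1 modulo [p] and large enough for every system and for the rotation of
   clusters. *)
pose m' := (M1 * (p * (Bm + 4 * Rmax + 1) + 1))%N; pose m := (m' * p ^ e)%N.
have M10 : (0 < M1)%N by rewrite part_gt0.
have pm' : ~~ (p %| m')%N.
  by rewrite Euclid_dvdM // negb_or pM1 /= dvdn_addr ?dvdn_mulr // Euclid_dvd1.
have Mm : (M0 %| m)%N by rewrite EM /m /m' mulnAC dvdn_mulr.
have lem : (Bm + 4 * Rmax + 1 <= m)%N.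
  have pe : (0 < p ^ e)%N by rewrite expn_gt0 prime_gt0.
  apply: leq_trans (leq_pmulr _ pe); apply: leq_trans (leq_pmull _ M10).
  by rewrite [leqRHS]addn1 ltnW // ltnS leq_pmull // prime_gt0.
have m0 : (0 < m)%N by apply: leq_trans lem; rewrite addn1.
pose f (z : I * {ffun J -> 'I_m}) := \sum_j c z.1 j * t ^ ((z.2 j : nat)%:Z).
have [Tl [HTS HTl]] := finite_witnesses (fun v => in_Sigma S v)
  (fun z v => vge v (f z) (v (t ^+ m - 1) - s%:Z * poleT v)).
have [N1 HN1] := list_bound Tl (fun v => v (t ^+ m - 1)).
exists Tl, N1; split=> // a Ha; set la := fun j => lin (L j) a.
(* Smallness on [Tl] passes to the sum with reduced exponents, from there to all places of Sigma,
   and back to any exponents in the same classes modulo [m]. *)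
have star i v (y : J -> int) : in_Sigma S v -> (forall j, (m%:Z %| y j - la j)%Z) ->
    vge v (\sum_j c i j * t ^ y j) (v (t ^+ m - 1) - s%:Z * poleT v).
  move=> vS Hy.
  have ltb j : (absz (la j %% m%:Z)%Z < m)%N.
    have := modz_ge0 (la j) (_ : m%:Z != 0); have := ltz_pmod (la j) (_ : 0 < m%:Z).
    by move: (la j %% m%:Z)%Z => r; lia.
  pose b : {ffun J -> 'I_m} := [ffun j => Ordinal (ltb j)].
  have bE j : (m%:Z %| (b j : nat)%:Z - la j)%Z.
    rewrite ffunE /=; have -> : (absz (la j %% m%:Z)%Z)%:Z = (la j %% m%:Z)%Z.
      by have := modz_ge0 (la j) (_ : m%:Z != 0); move: (la j %% m%:Z)%Z => r; lia.
    rewrite [X in _ - X](divz_eq (la j) m%:Z) opprD addrCA subrr addr0 rpredN.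
    exact: dvdz_mull.
  have := HTl (i, b) _ v vS; rewrite /f /= => H.
  apply: (periodic_sum (x := fun j => (b j : nat)%:Z) vS (Hc i)).
    move=> j; have -> : (b j : nat)%:Z - y j = ((b j : nat)%:Z - la j) - (y j - la j) by ring.
    exact: rpredB (bE j) (Hy j).
  apply: H => w wT; apply: (periodic_sum (x := la) (HTS w wT) (Hc i)).
    by move=> j; rewrite -opprB rpredN; apply: bE.
  apply: vge_le (Ha i w wT); have := HN1 w wT; have : 0 <= s%:Z * poleT w.
    by apply: mulr_ge0 => //; apply: poleT_ge0.
  by move: (s%:Z * poleT w) => z; plia.
pose P u := [set jj : J * J | `|cmod m (la jj.1 - la jj.2)| <= (Rk u)%:Z].
(* The relations grow with the scale inside a finite set, so at some scale no pair has its distance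
   in [(R1, R2]]. *)
have [|u leu EP] := @chain_stable _ P.
  move=> u; apply/subsetP => jj; rewrite !inE => /le_trans; apply.
  by rewrite lez_nat -addn1 Rmono.
set R1 := Rk u; set R2 := Rk u.+1.
have R12 : (R1 + R1 + G <= R2)%N by case: (HPhi R1).
have R2m : (R2 <= Rmax)%N by rewrite /R2 /Rmax (_ : N2.+1 = (u.+1 + (N2 - u))%N) ?Rmono // addSn subnKC.
have near j j' : ((j, j') \in P u) = (`|cmod m (la j - la j')| <= R1%:Z) by rewrite inE.
have near2 j j' : `|cmod m (la j - la j')| <= R2%:Z -> (j, j') \in P u.
  by move=> le; rewrite -EP inE.
have nearI j j' d : (m%:Z %| la j - la j' - d)%Z -> `|d| <= R2%:Z -> (j, j') \in P u.
  by move=> dv le; apply: near2; rewrite (cmod_uniq m0 dv) //; lia.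
have zero i j0 : \sum_(j | (j, j0) \in P u) c i j * t ^ cmod m (la j - la j0) = 0.
  under eq_bigl do rewrite near.
  apply: (cluster_vanish (T := T) t0 pq qt (s := s) (R1 := R1) (R2 := R2) (G := G)) => //.
  - by move: lem R2m; lia.
  - by move: R12; lia.
  - move=> y Hy lo hi; apply: (HG m' pm' (c i) y (- m%:Z + R2%:Z) (Hc i) lo).
      by move=> j; rewrite -/m; have := hi j; move: R12; lia.
    move=> v vS; have vt : v (t ^ la j0) = 0 by apply: placeXz0; [case: vS|apply: tS].
    have pv : is_place v by case: vS.
    rewrite -(vgeMl pv _ _ (expfz_neq0 (la j0) t0)) vt add0r.
    have -> : t ^ la j0 * \sum_j c i j * t ^ y j = \sum_j c i j * t ^ (y j + la j0).
      by rewrite mulr_sumr; apply: eq_bigr => j _; rewrite expfzDr //; ring.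
    apply: star => // j; have -> : y j + la j0 - la j = y j - (la j - la j0) by ring.
    exact: Hy.
  - by move=> j le; rewrite -near near2.
  - by case: (HPhi R1) => _ H; apply: H => j.
set E := P u in near near2 nearI zero.
pose av : 'cV[int]_n := \col_l a l.
pose d : 'cV[int]_#|{: J * J}| := \col_r (if enum_val r \in E
  then cmod m (la (enum_val r).1 - la (enum_val r).2) else 0).
have rowE (y : 'cV[int]_n) r : (row E *m y) r ord0 = if enum_val r \in E
    then lin (L (enum_val r).1) (fun l => y l ord0) - lin (L (enum_val r).2) (fun l => y l ord0)
    else 0.
  rewrite mxE; case: ifP => rE; last by rewrite big1 // => l _; rewrite mxE rE mul0r.
  by rewrite /lin -sumrB; apply: eq_bigr => l _; rewrite mxE rE mulrBl.
have [||||x Ex Nx] := HB E m _ _ av d.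
- by apply: dvdn_trans Mm; rewrite /M0 (bigD1 E) //= dvdn_mulr.
- by apply: leq_trans (HBm E) _; move: lem; lia.
- move=> r; rewrite mxE; case: ifP => // rE.
  have := near (enum_val r).1 (enum_val r).2; rewrite -surjective_pairing rE => /esym le.
  by apply: le_trans le _; rewrite lez_nat; move: R12 R2m; lia.
- move=> r; rewrite mxE rowE mxE [d r ord0]mxE; case: ifP => rE; last by rewrite subrr dvdz0.
  have laE j : lin (L j) (fun l => av l ord0) = la j.
    by apply: eq_bigr => l _; rewrite mxE.
  by rewrite !laE; case: (cmodP m0 (la (enum_val r).1 - la (enum_val r).2)).
exists (fun l => x l ord0) => [l|i]; first by have := Nx l; rewrite !mxE.
set lx := fun j => lin (L j) (fun l => x l ord0).
have lxE j j' : (j, j') \in E -> lx j = lx j' + cmod m (la j - la j').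
  move=> jE; have := congr1 (fun X : 'cV[int]__ => X (enum_rank (j, j')) ord0) Ex.
  rewrite rowE mxE enum_rankK jE /= -/(lx j) -/(lx j') => <-.
  by rewrite addrC subrK.
have dvE j j' : (m%:Z %| la j - la j' - cmod m (la j - la j'))%Z.
  by case: (cmodP m0 (la j - la j')).
(* Closeness is an equivalence relation: distances add up to at most [R1 + R1 <= R2], and pairs
   within [R2] are already within [R1]. *)
have Erefl j : (j, j) \in E by apply: (nearI _ _ 0); rewrite ?subrr ?dvdz0 ?normr0.
have Esym j j' : (j, j') \in E -> (j', j) \in E.
  rewrite near => le; apply: (nearI _ _ (- cmod m (la j - la j'))).
    have -> : la j' - la j - - cmod m (la j - la j') = - (la j - la j' - cmod m (la j - la j')).
      by ring.
    by rewrite rpredN; apply: dvE.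
  by move: le R12; rewrite normrN; lia.
have Etrans j1 j2 j3 : (j1, j2) \in E -> (j2, j3) \in E -> (j1, j3) \in E.
  rewrite (near j1 j2) (near j2 j3) => le1 le2.
  apply: (nearI _ _ (cmod m (la j1 - la j2) + cmod m (la j2 - la j3))).
    have -> : la j1 - la j3 - (cmod m (la j1 - la j2) + cmod m (la j2 - la j3))
      = (la j1 - la j2 - cmod m (la j1 - la j2)) + (la j2 - la j3 - cmod m (la j2 - la j3)) by ring.
    exact: rpredD (dvE _ _) (dvE _ _).
  by move: (cmod m (la j1 - la j2)) (cmod m (la j2 - la j3)) le1 le2 => y z; move: R12; lia.
pose cl j := [set j' | (j', j) \in E].
have clE j j' : (j' \in cl j) = ((j', j) \in E) by rewrite in_set.
clearbody E cl.
rewrite (partition_big cl predT) //=; apply: big1 => A _.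
have [[j0 /eqP clA]|no] := boolp.EM (exists j, cl j == A); last first.
  by apply: big1 => j clj; case: no; exists j.
rewrite (eq_bigl (fun j => (j, j0) \in E)) => [|j]; last first.
  apply/eqP/idP => [clj|jE].
    by rewrite -clE clA -clj clE.
  rewrite -clA; apply/setP => j'; rewrite !clE; apply/idP/idP => H.
    exact: Etrans H jE.
  by apply: Etrans H _; apply: Esym.
(* The integral solution reproduces the differences inside a cluster exactly, so the cluster
   contributes a power of [t] times a sum known to vanish. *)
rewrite (eq_bigr (fun j => t ^ lx j0 * (c i j * t ^ cmod m (la j - la j0)))) => [|j jE].
  by rewrite -mulr_sumr zero mulr0.
by rewrite -/(lx j) (lxE _ _ jE) expfzDr // mulrCA.
Qed.

Lemma exp_sum_approx (c : I -> J -> K) (N : nat) : (0 < N)%N ->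
  exists (Tl : seq (K -> int)) (N1 : int), (forall v, List.In v Tl -> in_Sigma S v) /\
    forall a : 'I_n -> int,
      (forall i v, List.In v Tl -> vge v (\sum_j c i j * t ^ lin (L j) a) N1) ->
      exists2 x : 'I_n -> int, forall l, (N%:Z %| x l - a l)%Z &
        forall i, \sum_j c i j * t ^ lin (L j) x = 0.
Proof.
move=> N0.
have [Q Q0 [s Hs]] : exists2 Q, Q != 0 & exists s, forall i j, bpoles s (Q * c i j).
  suff [Q Q0 [s [HQ Hs]]] : exists2 Q, Q != 0 & exists s, bpoles s Q /\
      forall ij, ij \in enum {: I * J} -> bpoles s (Q * c ij.1 ij.2).
    by exists Q => //; exists s => i j; apply: (Hs (i, j)); rewrite mem_enum.
  elim: (enum _) => [|ij r [Q Q0 [s [HQ Hs]]]].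
    by exists 1; rewrite ?oner_neq0 //; exists 0%N; split=> //; apply: bpoles1.
  have [D D0 [s' [HD HDc]]] := bpoles_denom genT (c ij.1 ij.2).
  exists (Q * D); first exact: mulf_neq0.
  exists (s + s')%N; split=> [|ij']; first exact: bpolesM.
  rewrite inE => /orP[/eqP->|ijr]; first by rewrite -mulrA; apply: bpolesM.
  by rewrite mulrAC; apply: bpolesM => //; apply: Hs.
have [Tl [N1 [HT Happ]]] := exp_sum_approx_bpoles Hs N0.
have [B HB] := list_bound Tl (fun v => - v Q).
have sumE i (x : 'I_n -> int) : \sum_j Q * c i j * t ^ lin (L j) x
    = Q * \sum_j c i j * t ^ lin (L j) x.
  by rewrite mulr_sumr; apply: eq_bigr => j _; rewrite mulrA.
exists Tl, (N1 + B); split=> // a Ha; have [i v vT|x Nx Hx] := Happ a.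
  have [pv _] := HT v vT; rewrite sumE.
  apply: vge_le (vgeM pv (vge_refl v Q) (Ha i v vT)); have := HB v vT; plia.
exists x => // i; apply/eqP; have /eqP := Hx i.
by rewrite sumE mulf_eq0 (negbTE Q0).
Qed.
End Approximation.

(** * Closures of subgroups *)

Lemma fraction_repr (R : idomainType) (a : {fraction R}) :
  exists n d : R, d != 0 /\ a = FracField.tofrac n / FracField.tofrac d.
Proof.
exists (frac (generic_quotient.repr a)).1, (frac (generic_quotient.repr a)).2.
split; first exact: denom_ratioP.
rewrite -[LHS]generic_quotient.reprK; move: (generic_quotient.repr a) => x.
rewrite -[_ / _]/(FracField.mul _ (FracField.inv _)) !generic_quotient.piE.
rewrite /FracField.mulf /FracField.invf.
by rewrite !numden_Ratio ?oner_neq0 ?denom_ratioP // mulr1 mul1r Ratio_numden.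
Qed.

Lemma ratgen_ratfun (p : nat) (K : fieldExtType (ratfun p)) :
  exists (iota : {rmorphism 'F_p -> K}) (T : K), ratgen iota T.
Proof.
pose iota : {rmorphism 'F_p -> K} :=
  (GRing.in_alg K \o @FracField.tofrac {poly 'F_p}) \o polyC.
exists iota, (FracField.tofrac 'X)%:A.
have evE A : ev iota (FracField.tofrac 'X)%:A A = (FracField.tofrac A)%:A.
  elim/poly_ind: A => [|A c IH]; first by rewrite !rmorph0 scale0r.
  rewrite rmorphD rmorphM /= IH evX evC /= [in RHS]rmorphD rmorphM /=.
  by rewrite scalerDl -scalerAl mul1r scalerA.
split=> [A|x].
  by rewrite evE => /eqP; rewrite scaler_eq0 oner_eq0 orbF tofrac_eq0 => /eqP.
split.
  case/vlineP => a ->; have [n [d [d0 ->]]] := fraction_repr a.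
  exists n, d; split=> //; rewrite !evE.
  by rewrite -(fmorph_div (GRing.in_alg K)).
by case=> A [B [B0 ->]]; rewrite !evE; apply: rpredM; rewrite ?rpredV rpredZ ?rpred1.
Qed.

Section SubgroupUnits.
Variables (F : fieldType) (K : fieldExtType F) (G : K -> Prop).
Hypothesis sG : is_subgroup_units G.

Lemma subgroup1 : G 1. Proof. by case: sG. Qed.
Lemma subgroup_neq0 x : G x -> x != 0. Proof. by case: sG => _ + _; apply. Qed.
Lemma subgroup_div x y : G x -> G y -> G (x / y). Proof. by case: sG => _ _; apply. Qed.
Lemma subgroupV x : G x -> G x^-1.
Proof. by move=> Gx; rewrite -div1r; apply: subgroup_div => //; apply: subgroup1. Qed.
Lemma subgroupM x y : G x -> G y -> G (x * y).
Proof. by move=> Gx Gy; rewrite -[y]invrK; apply: subgroup_div => //; apply: subgroupV. Qed.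
Lemma subgroupX x (n : nat) : G x -> G (x ^+ n).
Proof.
by move=> Gx; elim: n => [|n IH]; rewrite ?expr0 ?exprS; [exact: subgroup1|exact: subgroupM].
Qed.
Lemma subgroupXz x (n : int) : G x -> G (x ^ n).
Proof.
move=> Gx; case: n => n; first exact: subgroupX.
by rewrite NegzE -exprnN; apply: subgroupV; apply: subgroupX.
Qed.
End SubgroupUnits.

(** * Continuity at points of the completions *)

Section VAdicLimits.
Variables (F : fieldType) (K : fieldExtType F) (v : K -> int).
Hypothesis pv : is_place v.
Implicit Types (u w : nat -> K) (a b : K).

Lemma vnear_le (N N' : int) a u : N' <= N -> vnear v N a u -> vnear v N' a u.
Proof. by move=> le [n0 H]; exists n0 => n /H; apply: vge_le. Qed.

Lemma vnear_cauchy_val u : vcauchy v u -> ~ vnull v u ->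
  exists (N : int) (l : int), forall a, vnear v N a u -> a != 0 /\ v a = l.
Proof.
move=> cu nu; have [N HN] : exists N : int, forall n0, exists2 n, (n0 <= n)%N & ~~ vge v (u n) N.
  apply: boolp.contrapT => no; apply: nu => N; apply: boolp.contrapT => no'.
  apply: no; exists N => n0; apply: boolp.contrapT => no2; apply: no'; exists n0 => n le.
  by apply: boolp.contrapT => /negP nv; apply: no2; exists n.
have [n1 H1] := cu N; have [n le nv] := HN n1.
have un0 : u n != 0 by apply: contraNneq nv => ->; apply: vge0.
have lt : v (u n) + 1 <= N by move: nv; rewrite vgeE //; plia.
exists N, (v (u n)) => a [n2 H2].
have [m0 vm] : u (n1 + n2)%N != 0 /\ v (u (n1 + n2)%N) = v (u n).
  by apply: (vge_near pv) => //; apply: vge_le (H1 _ _ _ le); rewrite ?leq_addr.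
rewrite -vm; apply: (vge_near pv) => //; apply: vge_le (H2 _ _); rewrite ?leq_addl //.
by rewrite vm.
Qed.

Variables (M : nat) (x : 'I_M -> nat -> K).
Hypothesis cx : forall i, vcauchy v (x i).

(* Continuity at the limit point of [x]; the bound along [x] makes it stable under products. *)
Definition vcont (f : ('I_M -> K) -> K) : Prop :=
  (exists2 B : int, B <= 0 & exists n0, forall n, (n0 <= n)%N -> vge v (f (fun i => x i n)) B) /\
  forall N1 : int, exists N2 : int, forall g, (forall i, vnear v N2 (g i) (x i)) ->
    vnear v N1 (f g) (fun n => f (fun i => x i n)).

Lemma vcont_const c : vcont (fun=> c).
Proof.
split; last by move=> N1; exists 0 => g _; exists 0%N => n _; rewrite subrr vge0.
exists (Num.min 0 (v c)); first by rewrite ge_min lexx.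
by exists 0%N => n _; apply: vge_le (vge_refl v c); rewrite ge_min lexx orbT.
Qed.

Lemma vcont_proj i : vcont (fun g => g i).
Proof.
split; last by move=> N1; exists N1 => g; apply.
have [n0 H] := cx i 0; exists (Num.min 0 (v (x i n0))); first by rewrite ge_min lexx.
exists n0 => n le; rewrite -[x i n](subrK (x i n0)); apply: vgeD => //.
  by apply: vge_le (H _ _ le (leqnn _)); rewrite ge_min lexx.
by apply: vge_le (vge_refl v _); rewrite ge_min lexx orbT.
Qed.

Lemma vcontD f h : vcont f -> vcont h -> vcont (fun g => f g + h g).
Proof.
move=> [[B B0 [n1 H1]] Cf] [[D D0 [n2 H2]] Ch]; split.
  exists (B + D); first by lia.
  exists (n1 + n2)%N => n le; apply: vgeD => //.
    by apply: vge_le (H1 n _); lia.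
  by apply: vge_le (H2 n _); lia.
move=> N1; have [A HA] := Cf N1; have [A' HA'] := Ch N1.
exists (Num.max A A') => g Hg.
have [|m Hm] := HA g; first by move=> i; apply: vnear_le (Hg i); rewrite le_max lexx.
have [|m' Hm'] := HA' g; first by move=> i; apply: vnear_le (Hg i); rewrite le_max lexx orbT.
exists (m + m')%N => n le; rewrite opprD addrACA; apply: vgeD => //.
  by apply: Hm; lia.
by apply: Hm'; lia.
Qed.

Lemma vcontM f h : vcont f -> vcont h -> vcont (fun g => f g * h g).
Proof.
move=> [[B B0 [n1 H1]] Cf] [[D D0 [n2 H2]] Ch]; split.
  exists (B + D); first by lia.
  by exists (n1 + n2)%N => n le; apply: vgeM => //; [apply: H1|apply: H2]; lia.
move=> N1; have [A HA] := Cf (N1 - D); have [A' HA'] := Ch (Num.max 0 (N1 - B)).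
exists (Num.max A A') => g Hg.
have [|m Hm] := HA g; first by move=> i; apply: vnear_le (Hg i); rewrite le_max lexx.
have [|m' Hm'] := HA' g; first by move=> i; apply: vnear_le (Hg i); rewrite le_max lexx orbT.
exists (m + m' + n1 + n2)%N => n le.
set fn := f (fun i => x i n); set hn := h (fun i => x i n).
have -> : f g * h g - fn * hn = (f g - fn) * h g + fn * (h g - hn) by ring.
have dh : vge v (h g - hn) (Num.max 0 (N1 - B)) by apply: Hm'; lia.
apply: vgeD => //.
  have -> : N1 = N1 - D + D by ring.
  apply: vgeM => //; first by apply: Hm; lia.
  rewrite -[h g](subrK hn); apply: vgeD => //; last by apply: H2; lia.
  by apply: vge_le dh; rewrite le_max D0.
have -> : N1 = B + (N1 - B) by ring.
apply: vgeM => //; first by apply: H1; lia.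
by apply: vge_le dh; rewrite le_max lexx orbT.
Qed.

Lemma vcont_meval (P : {mpoly K[M]}) : vcont (fun g => P.@[g]).
Proof.
have eqcont f f' : f =1 f' -> vcont f -> vcont f'.
  by move=> /boolp.funext ->.
apply: (eqcont (fun g => \sum_(m <- msupp P) P@_m * \prod_i g i ^+ m i)).
  by move=> g; rewrite mevalE.
elim: (msupp P) => [|m r IH].
  by apply: (eqcont (fun=> 0)); [move=> g; rewrite big_nil|apply: vcont_const].
apply: (eqcont (fun g => P@_m * \prod_i g i ^+ m i + \sum_(m <- r) P@_m * \prod_i g i ^+ m i)).
  by move=> g; rewrite big_cons.
apply: vcontD => //; apply: vcontM; first exact: vcont_const.
elim: (index_enum _) => [|i s IHs].
  by apply: (eqcont (fun=> 1)); [move=> g; rewrite big_nil|apply: vcont_const].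
apply: (eqcont (fun g => g i ^+ m i * \prod_(i <- s) g i ^+ m i)).
  by move=> g; rewrite big_cons.
apply: vcontM => //; elim: (m i) => [|e IHe].
  by apply: (eqcont (fun=> 1)); [move=> g; rewrite expr0|apply: vcont_const].
apply: (eqcont (fun g => g i * g i ^+ e)); first by move=> g; rewrite exprS.
by apply: vcontM => //; apply: vcont_proj.
Qed.

Lemma meval_small (P : {mpoly K[M]}) : vnull v (fun n => P.@[fun i => x i n]) ->
  forall N1 : int, exists N2 : int, forall g, (forall i, vnear v N2 (g i) (x i)) ->
    vge v P.@[g] N1.
Proof.
move=> nP N1; have [_ /(_ N1) [N2 H]] := vcont_meval P; exists N2 => g /H [n1 H1].
have [n2 H2] := nP N1; rewrite -[P.@[g]](subrK P.@[fun i => x i (n1 + n2)%N]).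
by apply: vgeD => //; [apply: H1; apply: leq_addr|apply: H2; apply: leq_addl].
Qed.
End VAdicLimits.

Lemma list_uniform (V : Type) (Tl : seq V) (Q : V -> int -> Prop) :
  (forall v N N', N <= N' -> Q v N -> Q v N') ->
  (forall v, List.In v Tl -> exists N, Q v N) -> exists N, forall v, List.In v Tl -> Q v N.
Proof.
move=> mono; elim: Tl => [|v Tl IH] HT; first by exists 0.
have [N HN] := IH (fun w wT => HT w (or_intror wT)).
have [N' HN'] := HT v (or_introl erefl).
exists (Num.max N N') => w [<-|/HN]; last by apply: mono; rewrite le_max lexx.
by apply: mono HN'; rewrite le_max lexx orbT.
Qed.

Lemma fin_uniform (I : finType) (Q : I -> int -> Prop) :
  (forall i N N', N <= N' -> Q i N -> Q i N') ->
  (forall i, exists N, Q i N) -> exists N, forall i, Q i N.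
Proof.
move=> mono /boolp.choice[f Hf]; exists (\sum_i `|f i|) => i.
by apply: mono (Hf i); rewrite (bigD1 i) //= (le_trans (ler_norm _)) // lerDl sumr_ge0.
Qed.

(** If every index failed some test, the union of these tests at the largest precision would defeat
    all indices at once. *)
Lemma directed_pigeonhole (I : finType) (V : Type) (S : V -> Prop)
    (Q : I -> seq V -> int -> Prop) :
  (forall i T T' N N', (forall v, List.In v T' -> List.In v T) -> N' <= N -> Q i T N -> Q i T' N') ->
  (forall T N, (forall v, List.In v T -> S v) -> exists i, Q i T N) ->
  exists i, forall T N, (forall v, List.In v T -> S v) -> Q i T N.
Proof.
move=> mono HQ; apply: boolp.contrapT => no.
suff [T [N [HT H]]] : exists T N, (forall v, List.In v T -> S v) /\
    forall i, i \in enum I -> ~ Q i T N.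
  by have [i Qi] := HQ T N HT; apply: (H i) => //; rewrite mem_enum.
elim: (enum I) => [|i s [T [N [HT H]]]]; first by exists [::], 0.
have [T' [N' [HT' H']]] : exists T' N', (forall v, List.In v T' -> S v) /\ ~ Q i T' N'.
  apply: boolp.contrapT => no'; apply: no; exists i => T' N' HT'.
  by apply: boolp.contrapT => nQ; apply: no'; exists T', N'.
exists (T ++ T'), (Num.max N N'); split=> [v /(@List.in_app_or _ T T')[/HT|/HT']//|j].
rewrite inE => /orP[/eqP->|js] HQ'.
  apply: H'; apply: mono HQ'; last by rewrite le_max lexx orbT.
  by move=> v vT; apply: (@List.in_or_app _ T T'); right.
apply: (H j js); apply: mono HQ'; last by rewrite le_max lexx.
by move=> v vT; apply: (@List.in_or_app _ T T'); left.
Qed.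

(** * Points of the closure of [Gamma] on a variety *)

Section Closure.
Variables (k : finFieldType) (F : fieldType) (K : fieldExtType F).
Variables (iota : {rmorphism k -> K}) (T : K) (p : nat).
Hypothesis genT : ratgen iota T.
Hypothesis charp : p \in [pchar k].
Variables (S S0 : seq (K -> int)) (Gamma : K -> Prop).
Hypothesis sG : is_subgroup_units Gamma.
Hypothesis GS0 : forall x, Gamma x -> S_unit S0 x.

Let Gamma0 x := Gamma x /\ S_unit S x.

Lemma S_unit_subgroup (S' : seq (K -> int)) : is_subgroup_units (S_unit S').
Proof.
split.
- by split=> [|v pv _]; rewrite ?oner_neq0 ?place1.
- by move=> x [].
move=> x y [x0 Hx] [y0 Hy]; split; first by rewrite mulf_neq0 ?invr_eq0.
by move=> v pv nv; rewrite placeM ?invr_eq0 // placeV // Hx // Hy // subrr.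
Qed.

Let sG0 : is_subgroup_units Gamma0.
Proof.
have sU := S_unit_subgroup S; split.
- by split; [exact: subgroup1|exact: subgroup1].
- by move=> x [/(subgroup_neq0 sG)].
by move=> x y [Gx Ux] [Gy Uy]; split; [exact: subgroup_div|exact: subgroup_div].
Qed.

(** Elements with value 0 everywhere have no poles, so there are finitely many. If some value at [q]
    is nonzero, take [u] with the least positive one and divide by a power of [u] to reach value 0
    at [q]. In the relation given by the rank, comparing values at [q] removes [u]; so a nonzero
    power of the quotient is 1, and its value is 0 everywhere. The choice [t = u^-1] makes [q] a
    pole. *)
Lemma rank_one_structure : rank_le Gamma0 1 ->
  exists (t : K) (Z : seq K), [/\ Gamma t, forall z, z \in Z -> Gamma z,
    forall y, Gamma0 y -> exists2 z, z \in Z & exists n : int, y = z * t ^ n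
  & t = 1 \/ exists q, [/\ is_place q, q t < 0 & forall v, in_Sigma S v -> v t = 0]].
Proof.
move=> rk; have [v0 [pv0 _]] := exists_place_notin genT S.
have [L0 HL0] := bpoles0_finite genT pv0.
pose Z := [seq z <- L0 | boolp.asbool (Gamma z)].
have ZG z : z \in Z -> Gamma z by rewrite mem_filter => /andP[/boolp.asboolP].
have inZ z : Gamma z -> (forall v, is_place v -> v z = 0) -> z \in Z.
  move=> Gz Hz; rewrite mem_filter; apply/andP; split; first exact/boolp.asboolP.
  apply: HL0 => v pv; rewrite mul0r oppr0.
  by rewrite vgeE ?Hz //; apply: subgroup_neq0 Gz.
have [[y [q [Gy pq qy]]]|no] := boolp.EM (exists y q, [/\ Gamma0 y, is_place q & q y <> 0]); last first.
  exists 1, Z; split=> //; first exact: subgroup1; last by left.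
  move=> y Gy; exists y; last by exists 0; rewrite expr0z mulr1.
  apply: inZ => [|v pv]; first by case: Gy.
  by apply: boolp.contrapT => vy; apply: no; exists y, v.
have ex : exists n, boolp.asbool (exists2 y, Gamma0 y & q y = n.+1%:Z).
  exists (absz (q y)).-1; apply/boolp.asboolP.
  have [lt|ge] := ltP (q y) 0.
    by exists y^-1; [exact: subgroupV|rewrite placeV //; plia].
  by exists y => //; plia.
case: (ex_minnP ex) => g /boolp.asboolP [u Gu qu] ming.
have u0 := subgroup_neq0 sG0 Gu.
have dvg w : Gamma0 w -> exists n : int, q w = n * g.+1%:Z.
  move=> Gw; have w0 := subgroup_neq0 sG0 Gw.
  have := divz_eq (q w) g.+1%:Z; set c := (q w %/ _)%Z; set r := (q w %% _)%Z => E.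
  have r0 : 0 <= r by apply: modz_ge0.
  have ltr : r < g.+1%:Z by apply: ltz_pmod.
  have [r00|rn0] := eqVneq r 0; first by exists c; rewrite E r00 addr0.
  have [n rE] : exists n : nat, r = n.+1%:Z by exists (absz r).-1; plia.
  have := ming n; rewrite leqNgt; have -> : (n < g)%N by plia.
  suff -> : boolp.asbool (exists2 y, Gamma0 y & q y = n.+1%:Z) by move=> /(_ isT).
  apply/boolp.asboolP; exists (w / u ^ c).
    by apply: subgroup_div => //; apply: subgroupXz.
  rewrite placeM ?invr_eq0 ?expfz_neq0 // placeV // placeXz // qu -rE E.
  by rewrite addrC addKr.
exists u^-1, Z; split=> //.
- by case: (subgroupV sG0 Gu).
- move=> w Gw; have w0 := subgroup_neq0 sG0 Gw; have [n qw] := dvg w Gw.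
  exists (w / u ^ n); last by exists (- n); rewrite exprz_inv opprK divfK ?expfz_neq0.
  have Gz : Gamma0 (w / u ^ n) by apply: subgroup_div => //; apply: subgroupXz.
  have z0 := subgroup_neq0 sG0 Gz; set z := w / u ^ n in Gz z0 *.
  have qz : q z = 0.
    by rewrite /z placeM ?invr_eq0 ?expfz_neq0 // placeV // placeXz // qu qw subrr.
  apply: inZ => [|v pv]; first by case: Gz.
  have [|e [[i ei] E]] := rk (fun i => if i == ord0 then z else u).
    by move=> i; case: ifP.
  rewrite big_ord_recl big_ord1 /= in E.
  have := congr1 q E; rewrite placeM ?expfz_neq0 // !placeXz // qz mulr0 add0r place1 // qu.
  move/eqP; rewrite mulf_eq0 orbF => /eqP e1.
  rewrite e1 expr0z mulr1 in E.
  have e0 : e ord0 != 0.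
    have [E0|//] := eqVneq (e ord0) 0; case/negP: ei.
    have [->|->] : i = ord0 \/ i = lift ord0 ord0; last 2 first.
    - by rewrite E0.
    - by rewrite e1.
    by case: i => [[|[|//]] lti]; [left|right]; apply: val_inj.
  have := congr1 v E; rewrite placeXz // place1 // => /eqP.
  by rewrite mulf_eq0 (negbTE e0) => /eqP.
right; exists q; split=> [//||v [pv nS]].
  by rewrite placeV // qu.
by case: Gu => _ [_ /(_ v pv nS)]; rewrite placeV // => ->; rewrite oppr0.
Qed.

(** Residue orders give a common exponent modulo all listed places; by Frobenius, a further power
    [p ^ N] multiplies the order of vanishing by [p ^ N > N]. *)
Lemma exists_period (t : K) (Tl : seq (K -> int)) (N : nat) : t != 0 ->
  (forall v, List.In v Tl -> is_place v /\ v t = 0) ->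
  exists2 n, (0 < n)%N & forall v, List.In v Tl -> vge v (t ^+ n - 1) N%:Z.
Proof.
move=> t0 HT; have pr : prime p := pcharf_prime charp.
suff [n n0 Hn] : exists2 n, (0 < n)%N & forall v, List.In v Tl -> vge v (t ^+ n - 1) 1.
  exists (n * p ^ N)%N; first by rewrite muln_gt0 n0 expn_gt0 prime_gt0.
  move=> v vT; have [pv _] := HT v vT; rewrite (exp_pchar_sub1 iota charp).
  apply: vge_le (vgeX pv _ (Hn v vT)); rewrite natz lez_nat.
  by apply: ltnW; apply: ltn_expl; apply: prime_gt1.
elim: Tl HT => [|v Tl IH] HT; first by exists 1%N.
have [|n n0 Hn] := IH; first by move=> w wT; apply: HT; right.
have [pv vt] := HT v (or_introl erefl).
have [n' n'0 Hn'] := exists_residue_order pv genT t0 vt.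
exists (n * n')%N; first by rewrite muln_gt0 n0.
have key w (a b : nat) : is_place w -> w t = 0 -> (a %| b)%N -> vge w (t ^+ a - 1) 1 ->
    vge w (t ^+ b - 1) 1.
  move=> pw wt ab Ha; have [z|z] := eqVneq (t ^+ b - 1) 0; first by rewrite z vge0.
  have := periodic_expz pw t0 wt (m := a) (x := b) (y := 0).
  rewrite subr0 expr0z => /(_ ab).
  (* Because of the convention [v 0 = 0], [periodic_expz] yields too little when [t ^+ a = 1]; in
     that case [t ^+ b = 1] too. *)
  have [E|nz] := eqVneq (t ^+ a - 1) 0.
    move: ab z => /dvdnP[c ->]; rewrite mulnC exprM.
    by move/eqP: E; rewrite subr_eq0 => /eqP ->; rewrite expr1n subrr eqxx.
  by apply: vge_le; move: Ha; rewrite vgeE.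
move=> w [<-|wT]; first by apply: (key v n' (n * n')%N); rewrite ?dvdn_mull.
by have [pw wt] := HT w (or_intror wT); apply: (key w n (n * n')%N); rewrite ?dvdn_mulr //; apply: Hn.
Qed.

Section Variety.
Variables (M : nat) (W : seq {mpoly K[M]}).

(* On a coset of [t^Z] the polynomials of [W] become exponential sums over a common set of
   monomials. *)
Lemma meval_exp_sum (gam : 'I_M -> K) (t : K) : t != 0 ->
  exists (r : nat) (L : 'I_r -> 'I_M -> int) (c : 'I_(size W) -> 'I_r -> K),
    forall (i : 'I_(size W)) (a : 'I_M -> int), (W`_i).@[fun l => gam l * t ^ a l]
      = \sum_j c i j * t ^ lin (L j) a.
Proof.
move=> t0; pose ms := undup (flatten [seq msupp P | P <- W]).
exists (size ms), (fun j l => (nth 0%MM ms j l)%:Z),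
  (fun i j => (W`_i)@_(nth 0%MM ms j) * \prod_l gam l ^+ (nth 0%MM ms j l)).
move=> i a; rewrite mevalE.
pose G m := (W`_i)@_m * \prod_l (gam l * t ^ a l) ^+ m l.
have GE m : G m = (W`_i)@_m * (\prod_l gam l ^+ m l) * t ^ lin (fun l => (m l)%:Z) a.
  rewrite /G -mulrA; congr (_ * _).
  have -> : t ^ lin (fun l => (m l)%:Z) a = \prod_l t ^ ((m l)%:Z * a l).
    by rewrite /lin; elim/big_rec2: _ => [|l y z _ <-]; rewrite ?expr0z // expfzDr.
  rewrite -big_split /=; apply: eq_bigr => l _.
  by rewrite exprMn mulrC [_ * a l]mulrC -exprz_exp exprnP mulrC.
transitivity (\sum_(m <- ms) G m).
  rewrite [RHS](bigID (fun m => m \in msupp W`_i)) /= [X in _ + X]big1 ?addr0.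
    rewrite -[RHS]big_filter; apply: perm_big; apply: uniq_perm.
    - exact: msupp_uniq.
    - by rewrite filter_uniq ?undup_uniq.
    move=> m; rewrite mem_filter mem_undup; case mW: (m \in msupp _) => //=.
    by apply/esym/flatten_mapP; exists W`_i; rewrite ?mem_nth.
  by move=> m nm; rewrite /G memN_msupp_eq0 ?mul0r.
rewrite (big_nth 0%MM) big_mkord; apply: eq_bigr => j _.
by rewrite GE.
Qed.

Lemma closure_of_W_of_W_of_closure x : rank_le Gamma0 1 ->
  W_of_closure S Gamma W x -> closure_of_W S Gamma W x.
Proof.
move=> rk [onW Hcl]; split=> // Tu Nu HTu; have [Hx HW] := onW.
have cx v i : in_Sigma S v -> vcauchy v (x i v) by move=> vS; case: (Hx i v vS).
have nx v i : in_Sigma S v -> ~ vnull v (x i v) by move=> vS; case: (Hx i v vS).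
(* [S1] holds the only places of Sigma where elements of [Gamma] can have nonzero value. *)
have [S1 HS1] : exists S1, forall v, List.In v S1 <-> List.In v S0 /\ in_Sigma S v.
  elim: (S0) => [|v s [S1 H]]; first by exists [::]; split=> [|[]].
  have [vS|vS] := boolp.EM (in_Sigma S v).
    exists (v :: S1) => w; split=> [[<-|/H[ws wS]]|[[<-|ws] wS]].
    - by split=> //; left.
    - by split=> //; right.
    - by left.
    - by right; apply/H.
  exists S1 => w; split=> [/H[ws wS]|[[E|ws] wS]].
  - by split=> //; right.
  - by case: vS; rewrite E.
  - by apply/H.
have S1S v : List.In v S1 -> in_Sigma S v by move/HS1 => [].
have [N0 HN0] : exists N0, forall v, List.In v S1 -> forall i a b,
    vnear v N0 a (x i v) -> vnear v N0 b (x i v) -> v a = v b.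
  apply: list_uniform => [v N N' le H i a b Ha Hb|v vS1].
    by apply: H; [exact: vnear_le le Ha|exact: vnear_le le Hb].
  have vS := S1S v vS1; have [pv _] := vS.
  apply: (fin_uniform (Q := fun i N => forall a b, vnear v N a (x i v) ->
    vnear v N b (x i v) -> v a = v b)) => [i N N' le H a b Ha Hb|i].
    by apply: H; [exact: vnear_le le Ha|exact: vnear_le le Hb].
  have [N [l H]] := vnear_cauchy_val pv (cx v i vS) (nx v i vS).
  by exists N => a b /H[_ ->] /H[_ ->].
have /boolp.choice[g0 Hg0] : forall i, exists g, Gamma g /\
    forall v, List.In v S1 -> vnear v N0 g (x i v).
  by move=> i; have [_ /(_ S1 N0 S1S) [g [Gg Hg]]] := Hcl i; exists g.
(* Outside [S0] both elements are units, and on [S1] closeness to [x i] gives them equal values; so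
   all good approximations lie in one coset of [Gamma0]. *)
have G0 i g : Gamma g -> (forall v, List.In v S1 -> vnear v N0 g (x i v)) -> Gamma0 (g / g0 i).
  move=> Gg Hg; have [Gg0 Hg0i] := Hg0 i; split; first exact: subgroup_div.
  have [gn0 Ug] := GS0 Gg; have [g0n0 Ug0] := GS0 Gg0.
  split=> [|v pv nvS]; first by rewrite mulf_neq0 ?invr_eq0.
  rewrite placeM ?invr_eq0 // placeV //.
  have [vS0|vS0] := boolp.EM (List.In v S0); last by rewrite Ug // Ug0 // subrr.
  have vS1 : List.In v S1 by apply/HS1.
  by rewrite (HN0 v vS1 i _ _ (Hg v vS1) (Hg0i v vS1)) subrr.
have [t [Z [Gt ZG Zt tcase]]] := rank_one_structure rk.
have t0 : t != 0 := subgroup_neq0 sG Gt.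
pose z (f : {ffun 'I_M -> 'I_(size Z)}) i := Z`_(f i).
(* One choice of representatives in [Z] works at every precision; only the exponents of [t] still
   vary. *)
have [f Hf] : exists f, forall Tl N, (forall v, List.In v Tl -> in_Sigma S v) ->
    exists a : 'I_M -> int, forall i v, List.In v Tl ->
      vnear v N (g0 i * z f i * t ^ a i) (x i v).
  apply: directed_pigeonhole => [f Tl T' N N' sub le [a Ha]|Tl N HT].
    by exists a => i v vT'; apply: vnear_le le _; apply: Ha; apply: sub.
  have /boolp.choice[g Hg] : forall i, exists g, Gamma g /\
      forall v, List.In v (Tl ++ S1) -> vnear v (Num.max N N0) g (x i v).
    move=> i; have [_ /(_ (Tl ++ S1) (Num.max N N0)) [|g [Gg Hg]]] := Hcl i.
      by move=> v /(@List.in_app_or _ Tl S1) [/HT|/S1S].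
    by exists g.
  have /boolp.choice[fa Hfa] : forall i, exists ja : 'I_(size Z) * int,
      g i / g0 i = Z`_(ja.1) * t ^ ja.2.
    move=> i; have [Gg Hgi] := Hg i.
    have [|y yZ [n E]] := Zt (g i / g0 i).
      apply: G0 => // v vS1; apply: vnear_le (Hgi v _).
        by rewrite le_max lexx orbT.
      by apply: (@List.in_or_app _ Tl S1); right.
    have lt : (index y Z < size Z)%N by rewrite index_mem.
    by exists (Ordinal lt, n); rewrite /= nth_index.
  exists [ffun i => (fa i).1], (fun i => (fa i).2) => i v vT.
  have g0n0 : g0 i != 0 by apply: (subgroup_neq0 sG); case: (Hg0 i).
  have -> : g0 i * z [ffun i => (fa i).1] i * t ^ (fa i).2 = g i.
    by rewrite /z ffunE -mulrA -Hfa mulrC divfK.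
  apply: vnear_le (proj2 (Hg i) v _); first by rewrite le_max lexx.
  by apply: (@List.in_or_app _ Tl S1); left.
pose gam i := g0 i * z f i.
have Ggam i : Gamma (gam i).
  by apply: subgroupM => //; [case: (Hg0 i)|apply: ZG; apply: mem_nth].
have small v P (N1 : int) : in_Sigma S v -> P \in W -> exists N2 : int, forall g,
    (forall i, vnear v N2 (g i) (x i v)) -> vge v P.@[g] N1.
  move=> vS PW; have [pv _] := vS; apply: meval_small => // [i|]; first exact: cx.
  exact: HW.
(* If [t = 1], then [gam] itself approximates [x] at every precision; so [P.@[gam]] is arbitrarily
   small at a place of Sigma and must be 0. *)
case: tcase => [t1|[q [pq qt tS]]].
  exists gam; split=> // [P PW|i v vT]; last first.
    by have [a /(_ i v vT)] := Hf Tu Nu HTu; rewrite t1 exp1rz mulr1.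
  have [v vS] := exists_place_notin genT S; have [pv _] := vS.
  apply/eqP; apply: contraTT isT => nz.
  have [N2 HN2] := small v P (v P.@[gam] + 1) vS PW.
  have [|a Ha] := Hf [:: v] N2; first by move=> w [<-|].
  have := HN2 gam; rewrite vgeE // => H.
  suff : v P.@[gam] + 1 <= v P.@[gam] by plia.
  apply: H => i; have := Ha i v (or_introl erefl); rewrite t1 exp1rz mulr1; exact.
have [r [L [c Wc]]] := meval_exp_sum gam t0.
(* [N3] compensates for the values of the [gam i]. With [n] a period of [t] to precision [N3] on
   [Tu], exponents congruent modulo [n] give equally good approximations. *)
have [N3 HN3] : exists N3 : nat, forall v, List.In v Tu -> forall i, Nu <= N3%:Z + v (gam i).
  have [N HN] := list_bound Tu (fun v => Nu + \sum_i `|v (gam i)|).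
  exists (absz N) => v /HN le i; have : `|v (gam i)| <= \sum_i `|v (gam i)|.
    by rewrite [leRHS](bigD1 i) //= lerDl sumr_ge0.
  by move: le; move: (\sum_i _) => s; plia.
have [|n n0 Hn] := exists_period (Tl := Tu) N3 t0.
  by move=> v /HTu vS; split; [case: vS|apply: tS].
have [Tl [N1 [HTl Happ]]] := exp_sum_approx genT charp t0 tS pq qt L c n0.
have [N2 HN2] : exists N2, forall v, List.In v Tl -> forall i : 'I_(size W), forall g,
    (forall l, vnear v N2 (g l) (x l v)) -> vge v (W`_i).@[g] N1.
  apply: list_uniform => [v N N' le H i g Hg|v vT].
    by apply: H => l; apply: vnear_le le (Hg l).
  apply: (fin_uniform (Q := fun (i : 'I_(size W)) N => forall g,
    (forall l, vnear v N (g l) (x l v)) -> vge v (W`_i).@[g] N1)) => [i N N' le H g Hg|i].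
    by apply: H => l; apply: vnear_le le (Hg l).
  by apply: small; [apply: HTl|apply: mem_nth].
have [|a Ha] := Hf (Tu ++ Tl) (Num.max Nu N2).
  by move=> v /(@List.in_app_or _ Tu Tl) [/HTu|/HTl].
have [i v vT|b Nb Hb] := Happ a.
  rewrite -Wc; apply: (HN2 v vT i) => l; apply: vnear_le (Ha l v _).
    by rewrite le_max lexx orbT.
  by apply: (@List.in_or_app _ Tu Tl); right.
exists (fun l => gam l * t ^ b l); split.
- by move=> l; apply: subgroupM => //; apply: subgroupXz.
- move=> P PW; have lt : (index P W < size W)%N by rewrite index_mem.
  by have := Wc (Ordinal lt) b; rewrite /= nth_index // => ->; apply: Hb.
move=> l v vT; have vS := HTu v vT; have [pv _] := vS.
have [m Hm] : vnear v Nu (gam l * t ^ a l) (x l v).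
  apply: vnear_le (Ha l v _); first by rewrite le_max lexx.
  by apply: (@List.in_or_app _ Tu Tl); left.
have vd : vge v (gam l * t ^ b l - gam l * t ^ a l) Nu.
  rewrite -mulrBr; apply: vge_le (HN3 v vT l) _; rewrite [X in vge v _ X]addrC; apply: vgeM => //.
    exact: vge_refl.
  have [E|nz] := eqVneq (t ^+ n - 1) 0.
    have tn : t ^+ n = 1 by apply/eqP; rewrite -subr_eq0 E.
    case/dvdzP: (Nb l) => e Ee; have -> : b l = a l + n%:Z * e by rewrite mulrC -Ee addrC subrK.
    by rewrite expfzDr // -exprz_exp -exprnP tn exp1rz mulr1 subrr vge0.
  apply: vge_le (periodic_expz pv t0 (tS v vS) (Nb l)).
  by have := Hn v vT; rewrite vgeE.
exists m => e le; rewrite -[X in vge v X _](subrKA (gam l * t ^ a l)); apply: vgeD => //.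
exact: Hm.
Qed.
End Variety.
End Closure.

Theorem theorem2 (p : nat) (p_prime : prime p) (K : fieldExtType (ratfun p))
  (S S0 : seq (K -> int)) (Gamma : K -> Prop) :
  is_subgroup_units Gamma ->
  (forall x, Gamma x -> S_unit S0 x) ->
  rank_le (fun x => Gamma x /\ S_unit S x) 1 ->
  forall (M : nat) (W : seq {mpoly K[M]}) (x : 'I_M -> (K -> int) -> nat -> K),
    W_of_closure S Gamma W x <-> closure_of_W S Gamma W x.
Proof.
move=> sG GS0 rk M W x; have [iota [T genT]] := ratgen_ratfun K.
split; first exact: (closure_of_W_of_W_of_closure genT (pchar_Fp p_prime) sG GS0 rk).
move=> [onW H]; split=> // i; split; first by case: onW.
move=> Tl N HT; have [g [Gg _ Hg]] := H Tl N HT.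
by exists (g i); split=> // v; apply: Hg.
Qed.
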